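(* Let $X$ be a countable set and $m : X\to(0,\infty)$ a measure. Let $E$ be the edge set of a connected combinatorial graph over $X$, and let the operator $L\ge 0$ on $\ell^2(X,m)$ be a Laplacian based on the graph with edge set $E$, with $C_c(X)\subset D(L^n)$ for all natural numbers $n$. For $x,y\in X$ put $$d:=d_E(x,y),\qquad C(x,y):=\frac{\langle 1_x, L^{d+1}1_x\rangle+\langle 1_y,L^{d+1}1_y\rangle}{2\cdot (d+1)!}.$$ Then, for all $x,y\in X$, one has $$|\langle 1_x,L^d 1_y\rangle|>0,$$ and for all $t\ge 0$ the estimates $$\left|\langle 1_x,e^{-tL}1_y\rangle-t^{d}\cdot\frac{|\langle 1_x,L^{d}1_y\rangle|}{d!}\right|\le t^{d+1}\cdot C(x,y)$$ and $$\left||\langle 1_x,e^{-itL}1_y\rangle|-t^{d}\cdot\frac{|\langle 1_x,L^{d}1_y\rangle|}{d!}\right|\le t^{d+1}\cdot C(x,y)$$ hold.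
   Context: $\ell^2(X,m)$ is the complex Hilbert space of functions $f:X\to\mathbb{C}$ with $\sum_{x\in X}|f(x)|^2m(x)<\infty$, with its natural inner product $\langle\cdot,\cdot\rangle$ weighted by $m$. $C_c(X)$ is the set of functions on $X$ with finite support, and $1_x$ is the characteristic function of $\{x\}$. A combinatorial graph over $X$ is given by a set $E\subseteq X\times X$ (the edge set) such that $(x,y)\in E$ implies $(y,x)\in E$, and $(x,x)\notin E$ for all $x\in X$. A sequence $(x_1,\dots,x_n)$ in $X$ with $(x_j,x_{j+1})\in E$ for $j=1,\dots,n-1$ is a path from $x_1$ to $x_n$; its length is the number $n-1$ of its edges. The graph is connected if there is a path between any two points of $X$. In this case $d_E(x,y)$ is the smallest length of a path connecting $x$ and $y$ if $x\ne y$, and $d_E(x,x)=0$. A selfadjoint operator $L\ge 0$ on $\ell^2(X,m)$ with $C_c(X)\subseteq D(L^{1/2})$ is a Laplacian based on a graph with edge set $E$ if for any $x,y\in X$ with $x\neq y$ one has $\langle 1_x,L1_y\rangle:=\langle L^{1/2}1_x,L^{1/2}1_y\rangle\le 0$, with strict inequality if and only if $(x,y)\in E$. $D(A)$ denotes the domain of an operator $A$. The operators $L^n$, $L^{1/2}$, $e^{-tL}$, $e^{-itL}$ are defined by the spectral calculus, with $L^0$ the identity; the convention $0^0=1$ is used. *)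

(* Defs.v *)
From HB Require Import structures.
From mathcomp Require Import all_boot all_order all_algebra.
From mathcomp Require Import complex.
From mathcomp Require Import all_classical all_reals all_analysis.

Set Implicit Arguments.
Unset Strict Implicit.
Unset Printing Implicit Defensive.
Import Order.TTheory GRing.Theory Num.Theory.
Local Open Scope classical_set_scope.
Local Open Scope ring_scope.
Local Open Scope complex_scope.

Section Graph.
Variables (X : countType) (E : rel X).

Definition combinatorial_graph := symmetric E /\ irreflexive E.

(* The path (x, s_1, ..., s_n) has n edges. *)
Definition path_of_length (x y : X) (n : nat) :=
  exists s : seq X, [/\ path E x s, last x s = y & size s = n].

Definition graph_connected := forall x y, exists n, path_of_length x y n.

(* The default value 0 is only used when no path from x to y exists. *)
Definition gdist (x y : X) : nat :=
  if x == y then 0%N else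
  xget 0%N [set n | path_of_length x y n /\
                    forall k, path_of_length x y k -> (n <= k)%N].

End Graph.

(* A possibly unbounded operator; the values of [app] outside [dom] are
   meaningless. *)
Record operator (R : realType) (X : countType) := Operator {
  dom : set (X -> R[i]);
  app :> (X -> R[i]) -> (X -> R[i]) }.

Section Hilbert.
Variables (R : realType) (X : countType) (m : X -> R).
Implicit Types (u v w : X -> R[i]) (T S : operator R X).

Definition normsq u : \bar R :=
  (\esum_(x in [set: X]) (complex.Re (`|u x| ^+ 2) * m x)%:E)%E.

Definition ell2 : set (X -> R[i]) := [set u | (normsq u < +oo)%E].

(* The sum over X of an absolutely summable family; [\esum] is only meaningful
   for nonnegative families. *)
Definition rsum (f : X -> R) : R :=
  fine (\esum_(x in [set: X]) (EFin \o f)^\+ x)%E -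
  fine (\esum_(x in [set: X]) (EFin \o f)^\- x)%E.

Definition csum (f : X -> R[i]) : R[i] :=
  rsum (fun x => complex.Re (f x)) +i* rsum (fun x => complex.Im (f x)).

(* Antilinear in the first argument. *)
Definition inner u v : R[i] := csum (fun x => (u x)^* * v x * (m x)%:C).

Definition Cc : set (X -> R[i]) := [set u | finite_set [set x | u x != 0]].

Definition indicator (x : X) : X -> R[i] := fun y => (y == x)%:R.

Definition linear_operator T :=
  [/\ dom T `<=` ell2,
      (forall u, dom T u -> ell2 (T u)),
      (forall (a : R[i]) u v, dom T u -> dom T v -> dom T ((a \*o u) \+ v)) &
      (forall (a : R[i]) u v, dom T u -> dom T v ->
         T ((a \*o u) \+ v) = (a \*o T u) \+ T v)].

Definition densely_defined T := forall u (e : R), ell2 u -> 0 < e ->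
  exists2 v, dom T v & (normsq (u \- v)%R < e%:E)%E.

(* v belongs to the domain of the adjoint of T, which maps v to w. *)
Definition adjoint_graph T v w :=
  [/\ ell2 v, ell2 w & forall u, dom T u -> inner (T u) v = inner u w].

Definition selfadjoint T :=
  [/\ linear_operator T, densely_defined T &
      forall v w, adjoint_graph T v w <-> dom T v /\ T v = w].

Definition nonnegative_operator T := forall u, dom T u -> 0 <= inner u (T u).

Definition eq_operator T S :=
  dom T = dom S /\ forall u, dom T u -> T u = S u.

Section SpectralIntegral.
Variable P : set R -> (X -> R[i]) -> (X -> R[i]).

(* For an orthogonal projection, ||P(B) u||^2 = <u, P(B) u>. *)
Definition spectral_mu u : set R -> \bar R := fun B => normsq (P B u).

Definition projection_valued_measure :=
  [/\ (forall B u, measurable B -> ell2 u -> ell2 (P B u)),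
      (forall B (a : R[i]) u v, measurable B -> ell2 u -> ell2 v ->
         P B ((a \*o u) \+ v) = (a \*o P B u) \+ P B v),
      (forall B u v, measurable B -> ell2 u -> ell2 v ->
         inner (P B u) v = inner u (P B v)),
      (forall A B u, measurable A -> measurable B -> ell2 u ->
         P (A `&` B) u = P A (P B u)) &
      (forall u, ell2 u -> P setT u = u) /\
      (forall u, ell2 u -> semi_sigma_additive (spectral_mu u))].

Variable f : R -> R[i].

(* The integral of f against B |-> <u, P(B) u>. *)
Definition spectral_form u : R[i] :=
  fine (\int[spectral_mu u]_s (complex.Re (f s))%:E)%E +i*
  fine (\int[spectral_mu u]_s (complex.Im (f s))%:E)%E.

(* The integral of f against the complex measure B |-> <v, P(B) u>, which is
   recovered from the measures B |-> <h, P(B) h> by polarization. *)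
Definition spectral_sesquiform v u : R[i] :=
  4^-1 * \sum_(k < 4) (- 'i%C) ^+ k * spectral_form (v \+ ('i%C ^+ k \*o u)).

Definition spectral_dom : set (X -> R[i]) :=
  [set u | ell2 u /\
     (\int[spectral_mu u]_s (complex.Re (`|f s| ^+ 2))%:E < +oo)%E].

(* The operator \int f dP: its value at u is the vector w such that <v, w> is
   the integral of f against <v, P(.) u>.  Testing against v in the (dense)
   domain keeps the four integrals of the polarization formula finite, and
   determines w. *)
Definition spectral_integral : operator R X := Operator spectral_dom
  (fun u => xget (fun=> 0) [set w | ell2 w /\
     forall v, spectral_dom v -> inner v w = spectral_sesquiform v u]).

End SpectralIntegral.

Definition spectral_resolution T P :=
  projection_valued_measure P /\
  eq_operator T (spectral_integral P (fun s => s%:C)).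

(* f(T), formed with the spectral resolution of T.  By the spectral theorem a
   selfadjoint T has one, and only one; when T has none, f(T) is given the
   empty domain. *)
Definition spectral_calculus T (f : R -> R[i]) : operator R X :=
  if pselect (exists P, spectral_resolution T P) is left hP
  then spectral_integral (projT1 (cid hP)) f
  else Operator set0 id.

Definition op_pow T (n : nat) := spectral_calculus T (fun s => (s ^+ n)%:C).

(* [Num.sqrt] vanishes on the negative reals, outside the spectrum of T >= 0. *)
Definition op_sqrt T := spectral_calculus T (fun s => (Num.sqrt s)%:C).

(* exp(-tT) *)
Definition heat_operator T (t : R) :=
  spectral_calculus T (fun s => (expR (- t * s))%:C).

(* exp(-itT) *)
Definition unitary_operator T (t : R) :=
  spectral_calculus T (fun s => cos (t * s) -i* sin (t * s)).

Definition laplacian_based_on (E : rel X) (L : operator R X) :=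
  [/\ selfadjoint L,
      nonnegative_operator L,
      Cc `<=` dom (op_sqrt L) &
      forall x y, x != y ->
        let a := inner (op_sqrt L (indicator x)) (op_sqrt L (indicator y)) in
        a <= 0 /\ (a < 0 <-> E x y)].

End Hilbert.

(* Main.v *)
From HB Require Import structures.
Require Import Defs.
From mathcomp Require Import all_boot all_order all_algebra.
From mathcomp Require Import complex ring lra finmap.
From mathcomp Require Import all_classical all_reals all_analysis.
From mathcomp Require Import measurable_realfun.
Import Order.TTheory GRing.Theory Num.Theory.
Import numFieldNormedType.Exports HBNNSimple.
Local Open Scope classical_set_scope.
Local Open Scope complex_scope.
Local Open Scope ring_scope.
Set Implicit Arguments.
Unset Strict Implicit.
Unset Printing Implicit Defensive.

(** Let a_n(x, y) = <1_x, L^n 1_y>.  These numbers are the moments of the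
    complex measure <1_x, P(.) 1_y>, where P is the spectral resolution of L.

    Expanding <L 1_x, L^n 1_y> in coordinates gives the recursion
      a_(n+1)(x, y) = sum over z of conj(a_1(z, x)) a_n(z, y) / m(z),
    where a_1(z, x) for z <> x is negative on edges and zero elsewhere
    ([entryS], [entry1]).  By induction on n, a_n(x, y) = 0 as long as n is
    smaller than the distance d of x and y, and (-1)^d a_d(x, y) > 0: all the
    terms that contribute have the same sign, so there is no cancellation
    ([power_entries]).

    Expand exp(-ts) or exp(-its) at s = 0 to the order d under the integral.
    All terms but the one of order d vanish, and that one has the modulus
    t^d |a_d(x, y)| / d!.  On the spectrum s >= 0 the remainder is at most
    (ts)^(d+1) / (d+1)! ([expR_remainder], [cis_remainder]), and the integral
    of a function g against the complex measure is at most half the sum of the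
    integrals of |g| against the measures of x and of y ([sesquiform_bound]).
    This gives the constant C ([sesquiform_taylor], [entry_taylor]).

    Both the recursion and the last bound rest on the multiplicativity
      <f(L) u, g(L) v> = integral of conj(f) g against <u, P(.) v>
    ([represents_inner]).  For simple functions it is the identity
    P(A) P(B) = P(A `&` B); for square integrable ones, f(L) u is a limit of
    values at simple functions, which exists because l^2 is complete
    ([represents_exists]), and which is the vector that the weak definition
    of the spectral integral selects ([spectral_integral_represents]).  That
    the spectrum lies in [0, oo) follows by testing L >= 0 on the vectors
    P(A) u with A a bounded set of negative numbers ([specmu_negative]). *)

(** * Complex numbers *)

Section ComplexNumbers.
Variable R : realType.
Implicit Types (a z w : R[i]) (r : R).

Lemma conjE z : z^* = complex.Re z -i* complex.Im z.
Proof. by case: z. Qed.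

Lemma ltr0c r : (0 < r%:C) = (0 < r).
Proof. by rewrite ltcE /= eqxx. Qed.

Definition sqn z : R := complex.Re z ^+ 2 + complex.Im z ^+ 2.

Lemma sqnE z : complex.Re (`|z| ^+ 2) = sqn z.
Proof. by rewrite -add_Re2_Im2. Qed.

Lemma sqn_ge0 z : 0 <= sqn z.
Proof. by rewrite addr_ge0 ?sqr_ge0. Qed.

Lemma ReM z w : complex.Re (z * w) =
  complex.Re z * complex.Re w - complex.Im z * complex.Im w.
Proof. by case: z; case: w. Qed.

Lemma ImM z w : complex.Im (z * w) =
  complex.Re z * complex.Im w + complex.Im z * complex.Re w.
Proof. by case: z; case: w. Qed.

Lemma ReD z w : complex.Re (z + w) = complex.Re z + complex.Re w.
Proof. by case: z; case: w. Qed.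

Lemma ImD z w : complex.Im (z + w) = complex.Im z + complex.Im w.
Proof. by case: z; case: w. Qed.

Lemma Reconj z : complex.Re (z^*) = complex.Re z.
Proof. by case: z. Qed.

Lemma Imconj z : complex.Im (z^*) = - complex.Im z.
Proof. by case: z. Qed.

Lemma complex_eq z w : complex.Re z = complex.Re w ->
  complex.Im z = complex.Im w -> z = w.
Proof. by case: z => a b; case: w => c e /= -> ->. Qed.

Lemma sqnM z w : sqn (z * w) = sqn z * sqn w.
Proof. by case: z => a b; case: w => c e; rewrite /sqn /=; ring. Qed.

Lemma sqnN z : sqn (- z) = sqn z.
Proof. by case: z => a b; rewrite /sqn /=; ring. Qed.

Lemma sqn_conj z : sqn (z^*) = sqn z.
Proof. by case: z => a b; rewrite /sqn /=; ring. Qed.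

Lemma sqnD_le z w : sqn (z + w) <= 2 * sqn z + 2 * sqn w.
Proof.
case: z => a b; case: w => c e; rewrite /sqn /=.
by move: (sqr_ge0 (a - c)) (sqr_ge0 (b - e)) => *; lra.
Qed.

Lemma sqn_lin_le a z w : sqn (a * z + w) <= 2 * sqn a * sqn z + 2 * sqn w.
Proof. by apply: le_trans (sqnD_le _ _) _; rewrite sqnM mulrA. Qed.

Lemma sqn_real r : sqn r%:C = r ^+ 2.
Proof. by rewrite /sqn /= expr0n addr0. Qed.

Lemma sqn0 : sqn (0 : R[i]) = 0.
Proof. by rewrite sqn_real expr0n. Qed.

Lemma ReM_le z w : `|complex.Re (z * w)| <= sqn z + sqn w.
Proof.
case: z => a b; case: w => c e; rewrite /sqn /= ler_norml.
move: (sqr_ge0 (a - c)) (sqr_ge0 (b - e)) (sqr_ge0 (a + c)) (sqr_ge0 (b + e)).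
move: (sqr_ge0 a) (sqr_ge0 b) (sqr_ge0 c) (sqr_ge0 e).
by move=> *; apply/andP; split; lra.
Qed.

Lemma ImM_le z w : `|complex.Im (z * w)| <= sqn z + sqn w.
Proof.
case: z => a b; case: w => c e; rewrite /sqn /= ler_norml.
move: (sqr_ge0 (a - e)) (sqr_ge0 (b - c)) (sqr_ge0 (a + e)) (sqr_ge0 (b + c)).
move: (sqr_ge0 a) (sqr_ge0 b) (sqr_ge0 c) (sqr_ge0 e).
by move=> *; apply/andP; split; lra.
Qed.

End ComplexNumbers.

(** * Absolutely summable families *)

Section Sums.
Variables (R : realType) (X : countType).
Implicit Types (f g : X -> R) (F G : X -> R[i]).

Definition rsummable f := summable [set: X] (EFin \o f).
Definition csummable F :=
  rsummable (fun x => complex.Re (F x)) /\ rsummable (fun x => complex.Im (F x)).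

(** A real-valued sum, to be used on summable nonnegative families. *)
Definition possum f : R := fine (\esum_(x in [set: X]) (f x)%:E)%E.

Lemma rsummable_le f g : (forall x, `|f x| <= g x) -> rsummable g ->
  rsummable f.
Proof.
move=> fg; apply: le_lt_trans; apply: le_esum => x _ /=.
by rewrite lee_fin (le_trans (fg x))// ler_norm.
Qed.

Lemma rsummableD f g : rsummable f -> rsummable g ->
  rsummable (fun x => f x + g x).
Proof. exact: summableD. Qed.

Lemma rsummable_norm f : rsummable f -> rsummable (fun x => `|f x|).
Proof.
by apply: le_lt_trans; apply: le_esum => x _ /=; rewrite normr_id.
Qed.

Lemma esumZ (c : R) f : 0 <= c -> (forall x, 0 <= f x) ->
  (\esum_(x in [set: X]) (c * f x)%:E = c%:E * \esum_(x in [set: X]) (f x)%:E)%E.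
Proof.
have le (d : R) (h : X -> R) : 0 <= d -> (forall x, 0 <= h x) ->
    (\esum_(x in [set: X]) (d * h x)%:E
      <= d%:E * \esum_(x in [set: X]) (h x)%:E)%E.
  move=> d0 h0; apply: ge_ereal_sup => _ [A [finA AX] <-].
  under eq_fsbigr do rewrite EFinM.
  rewrite -ge0_mule_fsumr; last by move=> x; rewrite lee_fin.
  by rewrite lee_wpmul2l ?lee_fin//; apply: ereal_sup_ubound; exists A.
move=> c0 f0; apply/eqP; rewrite eq_le le//=.
have [->|cn0] := eqVneq c 0.
  by rewrite mul0e esum_ge0// => x _; rewrite mul0r.
have cp : 0 < c by rewrite lt_neqAle eq_sym cn0.
have := le c^-1 (fun x => c * f x); rewrite invr_ge0.
move=> /(_ c0 (fun x => mulr_ge0 c0 (f0 x))).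
under eq_esum do rewrite mulKf//.
move=> /(lee_wpmul2l (ltW (_ : (0 < c%:E)%E))) h; apply: le_trans (h _) _.
  by rewrite lte_fin.
by rewrite muleA -EFinM mulfV// mul1e.
Qed.

Lemma rsummableZ (c : R) f : rsummable f -> rsummable (fun x => c * f x).
Proof.
rewrite /rsummable /summable => fs.
under eq_esum do rewrite /= normrM.
rewrite esumZ//.
have : (\esum_(x in [set: X]) `|f x|%:E)%E \is a fin_num.
  by move: (summableE setT (EFin \o f)) => <-.
by move=> /fineK <-; rewrite -EFinM ltry.
Qed.

Lemma possum_ge0 f : (forall x, 0 <= f x) -> 0 <= possum f.
Proof. by move=> f0; apply/fine_ge0/esum_ge0 => x _; rewrite lee_fin. Qed.

Lemma esum_possum f : (forall x, 0 <= f x) -> rsummable f ->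
  (\esum_(x in [set: X]) (f x)%:E)%E = (possum f)%:E.
Proof.
move=> f0 fs; rewrite /possum fineK// ge0_fin_numE//.
  by apply: le_lt_trans fs; apply: le_esum => x _; rewrite lee_fin ler_norm.
by apply: esum_ge0 => x _; rewrite lee_fin.
Qed.

Lemma possumD f g : (forall x, 0 <= f x) -> (forall x, 0 <= g x) ->
  rsummable f -> rsummable g ->
  possum (fun x => f x + g x) = possum f + possum g.
Proof.
move=> f0 g0 fs gs; apply: EFin_inj; rewrite EFinD -!esum_possum//.
- by rewrite -esumD// => x _; rewrite lee_fin.
- by move=> x; rewrite addr_ge0.
- exact: rsummableD.
Qed.

Lemma possumZ (c : R) f : 0 <= c -> (forall x, 0 <= f x) -> rsummable f ->
  possum (fun x => c * f x) = c * possum f.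
Proof.
move=> c0 f0 fs; apply: EFin_inj; rewrite EFinM -!esum_possum//.
- by rewrite esumZ.
- by move=> x; rewrite mulr_ge0.
- exact: rsummableZ.
Qed.

(** Subtracting any two nonnegative families gives the sum that [rsum] takes
    from the positive and the negative part, since both ways of splitting
    differ by a common summable family. *)
Lemma rsumB f g : (forall x, 0 <= f x) -> (forall x, 0 <= g x) ->
  rsummable f -> rsummable g ->
  rsum (fun x => f x - g x) = possum f - possum g.
Proof.
move=> f0 g0 fs gs.
have hs : summable [set: X] (EFin \o (fun x => f x - g x)).
  exact: (summableB fs gs).
rewrite /rsum -fineB; last 2 first.
- rewrite (@eq_esum _ _ _ _ (abse \o (EFin \o (fun x => (f x - g x)%R))^\+)%E).
    by rewrite -summableE; exact: summable_funepos.
  by move=> x _; rewrite /= gee0_abs.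
- rewrite (@eq_esum _ _ _ _ (abse \o (EFin \o (fun x => (f x - g x)%R))^\-)%E).
    by rewrite -summableE; exact: summable_funeneg.
  by move=> x _; rewrite /= gee0_abs.
rewrite (_ : EFin \o _ = ((EFin \o f) \- (EFin \o g))%E)//.
rewrite esumB//; try by move=> x _; rewrite lee_fin.
by rewrite !esum_possum// -EFinB.
Qed.

Lemma rsum_ge0E f : (forall x, 0 <= f x) -> rsummable f -> rsum f = possum f.
Proof.
move=> f0 fs; rewrite -[RHS]subr0.
have p0 : possum (fun=> 0) = 0 :> R by rewrite /possum esum1.
rewrite -[X in _ - X]p0 -rsumB//; first by congr rsum; apply/funext => x; rewrite subr0.
by rewrite /rsummable /summable esum1// => x _; rewrite /= normr0.
Qed.

(** Signed sums inherit additivity and homogeneity from sums of nonnegative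
    families through this decomposition. *)
Lemma rsum_split f : rsummable f -> exists g h : X -> R,
  [/\ forall x, 0 <= g x, forall x, 0 <= h x, rsummable g, rsummable h &
      f = fun x => g x - h x].
Proof.
move=> fs; exists (fun x => (`|f x| + f x) / 2), (fun x => (`|f x| - f x) / 2).
have n1 x : f x <= `|f x| by exact: ler_norm.
have n2 x : - f x <= `|f x| by rewrite -normrN ler_norm.
split; last by apply/funext => x; lra.
- by move=> x; move: (n2 x); lra.
- by move=> x; move: (n1 x); lra.
- apply: rsummable_le (rsummable_norm fs) => x.
  by rewrite ler_norml; move: (n1 x) (n2 x) => ? ?; apply/andP; split; lra.
- apply: rsummable_le (rsummable_norm fs) => x.
  by rewrite ler_norml; move: (n1 x) (n2 x) => ? ?; apply/andP; split; lra.
Qed.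

Lemma rsumD f g : rsummable f -> rsummable g ->
  rsum (fun x => f x + g x) = rsum f + rsum g.
Proof.
move=> /rsum_split[a [b [a0 b0 sa sb ->]]] /rsum_split[c [e [c0 e0 sc se ->]]].
rewrite (_ : (fun _ => _) = (fun x => (a x + c x) - (b x + e x))); last first.
  by apply/funext => x; ring.
rewrite (rsumB a0 b0 sa sb) (rsumB c0 e0 sc se).
rewrite (rsumB _ _ (rsummableD sa sc) (rsummableD sb se)).
- by rewrite (possumD a0 c0 sa sc) (possumD b0 e0 sb se); ring.
- by move=> x; exact: addr_ge0.
- by move=> x; exact: addr_ge0.
Qed.

Lemma rsumN f : rsummable f -> rsum (fun x => - f x) = - rsum f.
Proof.
move=> /rsum_split[a [b [a0 b0 sa sb ->]]].
rewrite (_ : (fun _ => _) = (fun x => b x - a x)); last first.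
  by apply/funext => x; ring.
by rewrite (rsumB a0 b0 sa sb) (rsumB b0 a0 sb sa) opprB.
Qed.

Lemma rsumZ (c : R) f : rsummable f -> rsum (fun x => c * f x) = c * rsum f.
Proof.
wlog c0 : c / 0 <= c => [W|] fs.
  have [c0|c0] := leP 0 c; first exact: W.
  rewrite (_ : (fun _ => _) = (fun x => - ((- c) * f x))); last first.
    by apply/funext => x; ring.
  rewrite rsumN; last exact: rsummableZ.
  by rewrite W ?oppr_ge0 ?ltW//; ring.
move: fs => /rsum_split[a [b [a0 b0 sa sb ->]]].
rewrite (_ : (fun _ => _) = (fun x => c * a x - c * b x)); last first.
  by apply/funext => x; ring.
rewrite (rsumB a0 b0 sa sb) (rsumB _ _ (rsummableZ c sa) (rsummableZ c sb)).
- by rewrite (possumZ c0 a0 sa) (possumZ c0 b0 sb); ring.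
- by move=> x; exact: mulr_ge0.
- by move=> x; exact: mulr_ge0.
Qed.

Lemma rsum_ge f x : (forall x, 0 <= f x) -> rsummable f -> f x <= rsum f.
Proof.
move=> f0 fs; rewrite rsum_ge0E// -lee_fin -esum_possum//.
by apply: esum_ge; exists [set x]; rewrite ?fsbig_set1.
Qed.

Lemma rsum1 f x : (forall y, y != x -> f y = 0) -> rsum f = f x.
Proof.
have key g : (forall y, y != x -> g y = 0) -> (forall y, 0 <= g y) ->
    (\esum_(x in [set: X]) (g x)%:E)%E = (g x)%:E.
  move=> g0 gp; rewrite (esumID [set x])//; last by move=> y _; rewrite lee_fin.
  rewrite setTI esum_set1 ?lee_fin// esum1 ?adde0// => y [_ /= /eqP yx].
  by rewrite g0.
have fs g : (forall y, y != x -> g y = 0) -> rsummable g.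
  move=> g0; rewrite /rsummable /summable (key (fun x => `|g x|)) ?ltry//.
  by move=> y /g0 ->; rewrite normr0.
move=> f0.
have f1 y : y != x -> (`|f y| + f y) / 2 = 0.
  by move=> /f0 ->; rewrite normr0 addr0 mul0r.
have f2 y : y != x -> (`|f y| - f y) / 2 = 0.
  by move=> /f0 ->; rewrite normr0 subr0 mul0r.
have n1 y : f y <= `|f y| by exact: ler_norm.
have n2 y : - f y <= `|f y| by rewrite -normrN ler_norm.
have p1 y : 0 <= (`|f y| + f y) / 2 by move: (n2 y); lra.
have p2 y : 0 <= (`|f y| - f y) / 2 by move: (n1 y); lra.
rewrite [f in LHS](_ : _ = (fun y => (`|f y| + f y) / 2 - (`|f y| - f y) / 2)).
  rewrite (rsumB p1 p2 (fs _ f1) (fs _ f2)) /possum.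
  by rewrite (key _ f1 p1) (key _ f2 p2) /=; lra.
by apply/funext => y; lra.
Qed.

Lemma csumD F G : csummable F -> csummable G ->
  csum (fun x => F x + G x) = csum F + csum G.
Proof.
move=> [F1 F2] [G1 G2]; rewrite /csum.
rewrite (_ : (fun _ => complex.Re _) = fun x => complex.Re (F x) + complex.Re (G x)).
  rewrite rsumD//.
  rewrite (_ : (fun _ => complex.Im _) = fun x => complex.Im (F x) + complex.Im (G x)).
    by rewrite rsumD.
  by apply/funext => x; case: (F x); case: (G x).
by apply/funext => x; case: (F x); case: (G x).
Qed.

Lemma csumZ (a : R[i]) F : csummable F ->
  csum (fun x => a * F x) = a * csum F.
Proof.
move=> [F1 F2]; rewrite /csum.
under eq_fun do rewrite ReM -mulNr.
under [X in _ +i* rsum X]eq_fun do rewrite ImM.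
rewrite !rsumD ?rsumZ//; try exact: rsummableZ.
by case: a => a b; apply: complex_eq => /=; ring.
Qed.

Lemma csummableZ (a : R[i]) F : csummable F -> csummable (fun x => a * F x).
Proof.
move=> [F1 F2]; split.
  by under eq_fun do rewrite ReM -mulNr; apply: rsummableD; exact: rsummableZ.
by under eq_fun do rewrite ImM; apply: rsummableD; exact: rsummableZ.
Qed.

Lemma csum_conj F : csummable F -> csum (fun x => (F x)^*) = (csum F)^*.
Proof.
move=> [F1 F2]; rewrite conjE /csum /= -(rsumN F2).
rewrite (_ : (fun x => complex.Re _) = fun x => complex.Re (F x)).
  rewrite (_ : (fun x => complex.Im _) = fun x => - complex.Im (F x))//.
  by apply/funext => x; case: (F x).
by apply/funext => x; case: (F x).
Qed.

Lemma csum1 F x : (forall y, y != x -> F y = 0) -> csum F = F x.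
Proof.
move=> F0; rewrite /csum (@rsum1 _ x); last by move=> y /F0 ->.
rewrite (@rsum1 _ x); last by move=> y /F0 ->.
by case: (F x).
Qed.

Lemma csum_gt0 F x : csummable F -> (forall y, 0 <= F y) -> 0 < F x ->
  0 < csum F.
Proof.
move=> [Fr Fi] F0 Fx.
have im0 y : complex.Im (F y) = 0 by exact: ger0_Im.
have re0 y : 0 <= complex.Re (F y) by have := F0 y; rewrite lecE => /andP[].
rewrite ltcE /csum /=; apply/andP; split.
  by rewrite (@rsum1 _ x) ?im0.
apply: lt_le_trans (rsum_ge x re0 Fr).
by move: Fx; rewrite ltcE => /andP[].
Qed.

End Sums.

(** * Square summable functions *)

Section SquareSummable.
Variables (R : realType) (X : countType) (m : X -> R).
Hypothesis m_gt0 : forall x, 0 < m x.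
Implicit Types (u v w : X -> R[i]) (a z : R[i]).

(** The squared norm as a real number, meaningful on [ell2]. *)
Definition rnormsq u : R := fine (normsq m u).

Local Notation N := rnormsq.

Let wt u x : R := sqn (u x) * m x.

Let wt_ge0 u x : 0 <= wt u x.
Proof. by rewrite mulr_ge0 ?sqn_ge0 ?ltW. Qed.

Let normsq_wt u : normsq m u = (\esum_(x in [set: X]) (wt u x)%:E)%E.
Proof. by apply: eq_esum => x _; rewrite sqnE. Qed.

Let ell2_wt u : ell2 m u <-> rsummable (wt u).
Proof.
rewrite /ell2 /= normsq_wt /rsummable /summable.
by under [X in _ <-> is_true (X < _)%E]eq_esum do rewrite /= ger0_norm//.
Qed.

Let N_wt u : N u = possum (wt u).
Proof. by rewrite /rnormsq normsq_wt. Qed.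

Lemma normsq_fin u : ell2 m u -> normsq m u = (N u)%:E.
Proof. by move=> /ell2_wt us; rewrite normsq_wt N_wt esum_possum. Qed.

Lemma rnormsq_ge0 u : 0 <= N u.
Proof. by rewrite N_wt possum_ge0. Qed.

Lemma rnormsq_ge u x : ell2 m u -> sqn (u x) * m x <= N u.
Proof.
move=> /ell2_wt us; rewrite N_wt -rsum_ge0E//.
exact: (@rsum_ge _ _ (wt u) x).
Qed.

Lemma ell2_le_finite u (e : R) :
  (forall A : {fset X}, \sum_(x <- A) sqn (u x) * m x <= e) ->
  ell2 m u /\ N u <= e.
Proof.
move=> ule; have h : (normsq m u <= e%:E)%E.
  rewrite normsq_wt; apply: ge_ereal_sup => _ [A [finA _] <-].
  by rewrite fsbig_finite//= sumEFin lee_fin.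
have uell : ell2 m u by rewrite /ell2 /= (le_lt_trans h)// ltry.
by split=> //; rewrite -lee_fin -normsq_fin.
Qed.

Lemma sum_le_rnormsq u (A : {fset X}) : ell2 m u ->
  \sum_(x <- A) sqn (u x) * m x <= N u.
Proof.
move=> uell; rewrite -lee_fin -normsq_fin// normsq_wt -sumEFin.
apply: esum_ge; exists [set` A] => //.
rewrite fsbig_finite//=.
by rewrite set_fsetK.
Qed.

Lemma ell2_lin a u v : ell2 m u -> ell2 m v -> ell2 m ((a \*o u) \+ v).
Proof.
move=> /ell2_wt us /ell2_wt vs; apply/ell2_wt.
apply: rsummable_le (rsummableD (rsummableZ (2 * sqn a) us) (rsummableZ 2 vs)).
move=> x; rewrite ger0_norm// /wt /= !mulrA -mulrDl.
by rewrite ler_wpM2r ?(ltW (m_gt0 x))// sqn_lin_le.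
Qed.

Lemma ell2_0 : ell2 m (fun=> 0).
Proof.
rewrite /ell2 /= /normsq esum1 ?ltry// => x _.
by rewrite normr0 expr0n /= mul0r.
Qed.

Lemma ell2_scale a u : ell2 m u -> ell2 m (a \*o u).
Proof.
move=> us; have := ell2_lin a us ell2_0.
by congr (ell2 m); apply/funext => x /=; rewrite addr0.
Qed.

Lemma ell2_add u v : ell2 m u -> ell2 m v -> ell2 m (u \+ v).
Proof.
move=> us vs; have := ell2_lin 1 us vs.
by congr (ell2 m); apply/funext => x /=; rewrite mul1r.
Qed.

Lemma ell2_sub u v : ell2 m u -> ell2 m v -> ell2 m (u \- v).
Proof.
move=> us vs; have := ell2_lin (-1) vs us.
by congr (ell2 m); apply/funext => x /=; ring.
Qed.

Lemma inner_summable u v : ell2 m u -> ell2 m v ->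
  csummable (fun x => (u x)^* * v x * (m x)%:C).
Proof.
move=> /ell2_wt us /ell2_wt vs.
split; apply: rsummable_le (rsummableD us vs) => x; rewrite /wt /sqn -mulrDl.
  case: (u x) => a b; case: (v x) => c d /=.
  rewrite mulr0 subr0 normrM (ger0_norm (ltW (m_gt0 x))).
  rewrite ler_wpM2r ?(ltW (m_gt0 x))// ler_norml.
  move: (sqr_ge0 (a - c)) (sqr_ge0 (b - d)) (sqr_ge0 (a + c)) (sqr_ge0 (b + d)).
  by move=> *; apply/andP; split; nra.
case: (u x) => a b; case: (v x) => c d /=.
rewrite mulr0 add0r normrM (ger0_norm (ltW (m_gt0 x))).
rewrite ler_wpM2r ?(ltW (m_gt0 x))// ler_norml.
move: (sqr_ge0 (a - d)) (sqr_ge0 (b - c)) (sqr_ge0 (a + d)) (sqr_ge0 (b + c)).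
by move=> *; apply/andP; split; nra.
Qed.

Lemma innerDZr a u v w : ell2 m u -> ell2 m v -> ell2 m w ->
  inner m u ((a \*o v) \+ w) = a * inner m u v + inner m u w.
Proof.
move=> us vs ws; rewrite /inner -csumZ; last exact: inner_summable.
rewrite -csumD; last 2 first.
- have := inner_summable us (ell2_scale a vs).
  by congr csummable; apply/funext => x /=; ring.
- exact: inner_summable.
by congr csum; apply/funext => x /=; ring.
Qed.

Lemma inner_conj u v : ell2 m u -> ell2 m v -> inner m v u = (inner m u v)^*.
Proof.
move=> us vs; rewrite /inner -csum_conj; last exact: inner_summable.
congr csum; apply/funext => x.
case: (u x) => a b; case: (v x) => c d.
by apply/eqP; rewrite eq_complex /=; apply/andP; split; apply/eqP; ring.
Qed.

Lemma innerDZl a u v w : ell2 m u -> ell2 m v -> ell2 m w ->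
  inner m ((a \*o u) \+ v) w = a^* * inner m u w + inner m v w.
Proof.
move=> us vs ws; rewrite inner_conj//; last exact: ell2_lin.
rewrite innerDZr// (inner_conj us ws) (inner_conj vs ws).
case: a {us} => a b; case: (inner m w u) => c d; case: (inner m w v) => e f.
by apply/eqP; rewrite eq_complex /=; apply/andP; split; apply/eqP; ring.
Qed.

Lemma inner_self u : ell2 m u -> inner m u u = (N u)%:C.
Proof.
move=> us; rewrite /inner /csum.
rewrite [X in _ +i* rsum X](_ : _ = fun=> 0); last first.
  by apply/funext => x; case: (u x) => a b /=; ring.
rewrite [X in rsum X +i* _](_ : _ = wt u); last first.
  by apply/funext => x; rewrite /wt /sqn; case: (u x) => a b /=; ring.
rewrite (rsum_ge0E (wt_ge0 u) ((ell2_wt u).1 us)).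
rewrite N_wt (_ : rsum _ = 0)// rsum_ge0E//; first by rewrite /possum esum1.
by rewrite /rsummable /summable esum1 ?ltry// => x _ /=; rewrite normr0.
Qed.

Lemma inner0r u : ell2 m u -> inner m u (fun=> 0) = 0.
Proof.
move=> us; have := innerDZr (-1) us ell2_0 ell2_0.
rewrite (_ : _ \+ _ = fun=> 0); first by move=> ->; ring.
by apply/funext => x /=; ring.
Qed.

Lemma inner0l u : ell2 m u -> inner m (fun=> 0) u = 0.
Proof.
by move=> us; rewrite (inner_conj us ell2_0) inner0r// conjC0.
Qed.

Lemma rnormsq_lin a u v : ell2 m u -> ell2 m v ->
  N ((a \*o u) \+ v) =
  sqn a * N u + N v + 2 * complex.Re (a^* * inner m u v).
Proof.
move=> us vs; have us' := ell2_scale a us; apply: complexI.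
have uv := ell2_lin a us vs.
rewrite -inner_self// innerDZl// !innerDZr// !inner_self// (inner_conj us vs).
by rewrite /sqn; case: a {us' uv} => a b; case: (inner _ u v) => c d;
   apply/eqP; rewrite eq_complex /=; apply/andP; split; apply/eqP; ring.
Qed.

Lemma rnormsq_scale a u : ell2 m u -> N (a \*o u) = sqn a * N u.
Proof.
move=> us; have := rnormsq_lin a us ell2_0.
have N0 : N (fun=> 0) = 0.
  by rewrite /rnormsq /normsq esum1// => x _; rewrite normr0 expr0n /= mul0r.
rewrite N0 (inner0r us) mulr0 /= mulr0 !addr0 => <-.
by congr N; apply/funext => x /=; rewrite addr0.
Qed.

Lemma rnormsq_add u v : ell2 m u -> ell2 m v ->
  N (u \+ v) = N u + N v + 2 * complex.Re (inner m u v).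
Proof.
move=> us vs; rewrite (_ : u \+ v = (1 \*o u) \+ v); last first.
  by apply/funext => x /=; rewrite mul1r.
by rewrite rnormsq_lin// conjC1 mul1r /sqn; case: (inner _ _ _) => c d /=; ring.
Qed.

Lemma rnormsq_sub u v : ell2 m u -> ell2 m v ->
  N (u \- v) = N u + N v - 2 * complex.Re (inner m u v).
Proof.
move=> us vs; rewrite (_ : u \- v = ((-1) \*o v) \+ u); last first.
  by apply/funext => x /=; ring.
rewrite rnormsq_lin// (inner_conj us vs) /sqn.
by case: (inner _ _ _) => a b /=; ring.
Qed.

Lemma parallelogram u v : ell2 m u -> ell2 m v ->
  N (u \+ v) + N (u \- v) = 2 * N u + 2 * N v.
Proof. by move=> us vs; rewrite rnormsq_add// rnormsq_sub//; ring. Qed.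

(** Polarization, with the coefficients of [spectral_sesquiform]: it identifies
    the sesquilinear form of an indicator function with an inner product. *)
Lemma inner_polar v u : ell2 m v -> ell2 m u ->
  inner m v u =
  4^-1 * \sum_(k < 4) (- 'i%C) ^+ k * (N (v \+ ('i%C ^+ k \*o u)))%:C.
Proof.
move=> vs us; rewrite !big_ord_recr big_ord0 /=.
have e a : N (v \+ (a \*o u)) =
    N v + sqn a * N u + 2 * complex.Re (a * inner m v u).
  rewrite (_ : _ \+ _ = (a \*o u) \+ v); last first.
    by apply/funext => x /=; rewrite addrC.
  rewrite rnormsq_lin// (inner_conj vs us) /sqn.
  by case: a => a b; case: (inner _ _ _) => c d /=; ring.
rewrite !e /sqn !exprS !expr0; move: (inner m v u) => [c d] /=.
rewrite (_ : 4^-1 = (4^-1 : R)%:C); last by rewrite fmorphV rmorph_nat.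
apply/eqP; rewrite eq_complex /=; apply/andP; split; apply/eqP; by field.
Qed.

(** The squared norm of t u + v is a nonnegative quadratic polynomial in t,
    evaluated at its minimum. *)
Lemma CauchySchwarz u v : ell2 m u -> ell2 m v ->
  complex.Re (inner m u v) ^+ 2 <= N u * N v.
Proof.
move=> us vs; set r := complex.Re _.
have key t : 0 <= t ^+ 2 * N u + N v + 2 * t * r.
  have := rnormsq_ge0 ((t%:C \*o u) \+ v); rewrite rnormsq_lin//.
  rewrite /r /sqn; case: (inner _ _ _) => a b /=.
  by rewrite oppr0 mul0r subr0 expr0n addr0 mulrA.
have := rnormsq_ge0 u; rewrite le_eqVlt => /predU1P[Nu0|Nu].
  rewrite -Nu0 mul0r.
  have [->|r0] := eqVneq r 0; first by rewrite expr0n.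
  have := key (- (N v + 1) / (2 * r)); rewrite -Nu0 mulr0 add0r.
  rewrite (_ : 2 * _ * r = - (N v + 1)); last by field.
  by move=> h; exfalso; move: h; lra.
have := key (- r / N u).
rewrite (_ : _ + _ = (N u * N v - r ^+ 2) / N u); last first.
  by field; rewrite gt_eqF.
by rewrite pmulr_lge0 ?invr_gt0// subr_ge0.
Qed.

(** The arithmetic-geometric form of the Cauchy-Schwarz inequality: after
    rotating u by a phase that makes the inner product equal to minus its
    modulus, expand the squared norm of u + v. *)
Lemma inner_abs_le u v : ell2 m u -> ell2 m v ->
  `|inner m u v| <= ((N u + N v) / 2)%:C.
Proof.
move=> us vs; have [i0|i0] := eqVneq (inner m u v) 0.
  by rewrite i0 normr0 ler0c divr_ge0// addr_ge0// rnormsq_ge0.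
pose z := inner m u v; pose c := - (z / `|z|).
have := rnormsq_ge0 ((c \*o u) \+ v); rewrite rnormsq_lin//.
have zn : `|z| != 0 by rewrite normr_eq0.
have sc : sqn c = 1.
  apply: complexI; rewrite /sqn add_Re2_Im2 /c normrN normf_div normr_id.
  by rewrite divff// expr1n.
have cz : c^* * z = - `|z|.
  have h : (- (z / `|z|))^* = - (z^* / `|z|).
    rewrite [LHS]rmorphN [X in - X]rmorphM [X in _ * X]fmorphV /=.
    by rewrite (conj_Creal (normr_real z)).
  rewrite /c h mulNr mulrAC [_ * z]mulrC -normCK expr2 -mulrA divff//.
  by rewrite mulr1.
rewrite sc cz mul1r -/z [in `|z| <= _]normc_def lecR normc_def.
by case: (z) => a b /=; set s := Num.sqrt _; lra.
Qed.

Lemma ell2_indicator x : ell2 m (@indicator R X x).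
Proof.
have := @ell2_le_finite (@indicator R X x) (m x); case=> // A.
have e y : sqn (indicator R x y) * m y = if y == x then m x else 0.
  rewrite /indicator /sqn; case: eqVneq => [->|_] /=.
    by rewrite expr1n expr0n /= addr0 mul1r.
  by rewrite expr0n /= addr0 mul0r.
under eq_bigr do rewrite e.
rewrite -big_mkcond /= big_const_seq iter_addr addr0.
have : (count_mem x A <= 1)%N by rewrite count_uniq_mem ?fset_uniq ?leq_b1.
by case: (count_mem x A) => [|[|//]] _; rewrite ?mulr1n// mulr0n ltW.
Qed.

Lemma inner_indicator x u : inner m (indicator R x) u = u x * (m x)%:C.
Proof.
rewrite /inner (@csum1 _ _ _ x).
  by rewrite /indicator eqxx conjC1 mul1r.
by move=> y /negbTE yx; rewrite /indicator yx conjC0 !mul0r.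
Qed.

(** Vectors are tested on indicators, as the inner product with an indicator
    reads off a coordinate. *)
Lemma eq_inner_indicator u v :
  (forall x, inner m (indicator R x) u = inner m (indicator R x) v) -> u = v.
Proof.
move=> h; apply/funext => x; have := h x; rewrite !inner_indicator.
apply: mulIf; rewrite eq_complex /= negb_and; apply/orP; left.
by rewrite gt_eqF.
Qed.

Lemma Cc_indicator x : Cc (@indicator R X x).
Proof.
apply: (@sub_finite_set _ _ [set x]); last exact: finite_set1.
move=> y; rewrite /= /indicator; have [->//|] := eqVneq y x.
by rewrite eqxx.
Qed.

Lemma cvg_rnormsq (s : nat -> X -> R[i]) w : (forall n, ell2 m (s n)) -> ell2 m w ->
  N (s n \- w) @[n --> \oo] --> 0 -> N (s n) @[n --> \oo] --> N w.
Proof.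
move=> ss ws s0.
have e n : N (s n) = N w + N (s n \- w) + 2 * complex.Re (inner m w (s n \- w)).
  rewrite -rnormsq_add//; last exact: ell2_sub.
  by congr N; apply/funext => x /=; ring.
under eq_cvg do rewrite e.
suff h : complex.Re (inner m w (s n \- w)) @[n --> \oo] --> 0.
  have l : N w + N (s n \- w) + 2 * complex.Re (inner m w (s n \- w))
      @[n --> \oo] --> N w + 0 + 2 * 0.
    apply: cvgD; first by apply: cvgD => //; exact: cvg_cst.
    by apply: cvgM => //; exact: cvg_cst.
  by move: l; rewrite mulr0 !addr0.
have sq0 : Num.sqrt (N w * N (s n \- w)) @[n --> \oo] --> 0.
  rewrite -sqrtr0 -(mulr0 (N w)).
  apply: continuous_cvg; first exact: sqrt_continuous.
  by apply: cvgM => //; exact: cvg_cst.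
have b n : `|complex.Re (inner m w (s n \- w))| <= Num.sqrt (N w * N (s n \- w)).
  rewrite -sqrtr_sqr ler_wsqrtr// CauchySchwarz//; exact: ell2_sub.
apply: (@squeeze_cvgr _ _ _ _ (fun n => - Num.sqrt (N w * N (s n \- w)))
  (fun n => Num.sqrt (N w * N (s n \- w)))) => //.
  by near=> n; rewrite -ler_norml.
by rewrite -oppr0; exact: cvgN.
Unshelve. all: by end_near. Qed.

End SquareSummable.

(** * Limits of square summable functions *)

Section Limits.
Variables (R : realType) (X : countType) (m : X -> R).
Hypothesis m_gt0 : forall x, 0 < m x.
Implicit Types (u v w : X -> R[i]) (a z : R[i]).
Local Notation N := (rnormsq m).

Lemma rnormsq_lin_le a u v : ell2 m u -> ell2 m v ->
  N ((a \*o u) \+ v) <= 2 * sqn a * N u + 2 * N v.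
Proof.
move=> us vs; have aus := ell2_scale m_gt0 a us.
have := parallelogram m_gt0 aus vs; rewrite (rnormsq_scale m_gt0 a us) mulrA => <-.
by rewrite lerDl rnormsq_ge0.
Qed.

Lemma cvg_squeeze0 (f g : nat -> R) : (forall n, 0 <= f n <= g n) ->
  g n @[n --> \oo] --> 0 -> f n @[n --> \oo] --> 0.
Proof.
move=> fg; apply: (squeeze_cvgr _ (cvg_cst 0)).
by near=> n; exact: fg.
Unshelve. all: by end_near. Qed.

Lemma cvg_lin (s t : nat -> X -> R[i]) a u v :
  (forall n, ell2 m (s n)) -> (forall n, ell2 m (t n)) -> ell2 m u -> ell2 m v ->
  N (s n \- u) @[n --> \oo] --> 0 -> N (t n \- v) @[n --> \oo] --> 0 ->
  N (((a \*o s n) \+ t n) \- ((a \*o u) \+ v)) @[n --> \oo] --> 0.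
Proof.
move=> ss ts us vs su tv.
apply: (@cvg_squeeze0 _
  (fun n => 2 * sqn a * N (s n \- u) + 2 * N (t n \- v))) => [n|].
  rewrite rnormsq_ge0//= [X in N X](_ : _ = (a \*o (s n \- u)) \+ (t n \- v)).
    by rewrite rnormsq_lin_le//; exact: ell2_sub.
  by apply/funext => x /=; ring.
have : 2 * sqn a * N (s n \- u) + 2 * N (t n \- v)
    @[n --> \oo] --> 2 * sqn a * 0 + 2 * 0.
  by apply: cvgD; (apply: cvgM; [exact: cvg_cst|by []]).
by rewrite !mulr0 addr0.
Qed.

(** By polarization it suffices that squared norms converge. *)
Lemma cvg_inner_Re (s t : nat -> X -> R[i]) a u v :
  (forall n, ell2 m (s n)) -> (forall n, ell2 m (t n)) -> ell2 m u -> ell2 m v ->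
  N (s n \- u) @[n --> \oo] --> 0 -> N (t n \- v) @[n --> \oo] --> 0 ->
  complex.Re (a^* * inner m (s n) (t n)) @[n --> \oo] -->
  complex.Re (a^* * inner m u v).
Proof.
move=> ss ts us vs su tv.
have e u' v' : ell2 m u' -> ell2 m v' -> complex.Re (a^* * inner m u' v') =
    2^-1 * (N ((a \*o u') \+ v') - sqn a * N u' - N v').
  by move=> us' vs'; rewrite (rnormsq_lin m_gt0 a us' vs'); field.
rewrite e//; under eq_cvg do rewrite e//.
apply: cvgM; first exact: cvg_cst.
apply: cvgB; last exact: cvg_rnormsq.
apply: cvgB; last by apply: cvgM; [exact: cvg_cst|exact: cvg_rnormsq].
by apply: cvg_rnormsq => //; [move=> n; exact: ell2_lin|exact: ell2_lin|exact: cvg_lin].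
Qed.

Lemma cvg_inner (s t : nat -> X -> R[i]) u v :
  (forall n, ell2 m (s n)) -> (forall n, ell2 m (t n)) -> ell2 m u -> ell2 m v ->
  N (s n \- u) @[n --> \oo] --> 0 -> N (t n \- v) @[n --> \oo] --> 0 ->
  complex.Re (inner m (s n) (t n)) @[n --> \oo] --> complex.Re (inner m u v) /\
  complex.Im (inner m (s n) (t n)) @[n --> \oo] --> complex.Im (inner m u v).
Proof.
move=> ss ts us vs su tv; split.
  have := @cvg_inner_Re _ _ 1 _ _ ss ts us vs su tv.
  by under eq_cvg do rewrite conjC1 mul1r; rewrite conjC1 mul1r.
have e z : complex.Re ('i%C^* * z) = complex.Im z.
  by rewrite conjE; case: z => c d /=; ring.
have := @cvg_inner_Re _ _ 'i%C _ _ ss ts us vs su tv.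
by under eq_cvg do rewrite e; rewrite e.
Qed.

Let cvg_rsum (A : seq X) (f : X -> nat -> R) (l : X -> R) :
  (forall x, f x k @[k --> \oo] --> l x) ->
  \sum_(x <- A) f x k @[k --> \oo] --> \sum_(x <- A) l x.
Proof.
move=> fl; elim: A => [|x A IH].
  by rewrite big_nil; under eq_cvg do rewrite big_nil; exact: cvg_cst.
rewrite big_cons; under eq_cvg do rewrite big_cons.
exact: cvgD.
Qed.

Let coord_cvg (r : nat -> R) (c : R) : 0 < c ->
  (forall e : R, 0 < e -> exists n0, forall n k, (n0 <= n)%N -> (n0 <= k)%N ->
    (r n - r k) ^+ 2 * c <= e) -> cvgn r.
Proof.
move=> c0 h; apply/cauchy_cvgP; apply: cauchy_exP => e e0.
have [|n0 hn] := h (e ^+ 2 / 2 * c).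
  by rewrite !mulr_gt0// exprn_gt0.
exists (r n0); exists n0 => // n /= n0n.
have := hn n0 n (leqnn _) n0n; rewrite ler_pM2r// => le.
rewrite -ball_normE /= -(@ltr_pXn2r _ 2%N) ?nnegrE ?normr_ge0 ?(ltW e0)//.
rewrite real_normK ?num_real//.
have : 0 < e ^+ 2 by rewrite exprn_gt0.
lra.
Qed.

(** Coordinates of a Cauchy sequence converge; the Cauchy estimate holds for
    each finite partial sum of the squared norm, hence in the limit for the
    difference with the coordinatewise limit. *)
Lemma ell2_complete (s : nat -> X -> R[i]) : (forall n, ell2 m (s n)) ->
  (forall e : R, 0 < e -> exists n0, forall n k, (n0 <= n)%N -> (n0 <= k)%N ->
    N (s n \- s k) <= e) ->
  exists2 w, ell2 m w & N (s n \- w) @[n --> \oo] --> 0.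
Proof.
move=> ss cs.
have cRe x : cvgn (fun n => complex.Re (s n x)).
  apply: (coord_cvg (m_gt0 x)) => e /cs[n0 hn]; exists n0 => n k n0n n0k.
  apply: le_trans (hn n k n0n n0k).
  apply: le_trans (rnormsq_ge m_gt0 x (ell2_sub m_gt0 (ss n) (ss k))).
  rewrite ler_wpM2r ?(ltW (m_gt0 x))// /sqn /=.
  by case: (s n x) => a b; case: (s k x) => c d /=; rewrite lerDl sqr_ge0.
have cIm x : cvgn (fun n => complex.Im (s n x)).
  apply: (coord_cvg (m_gt0 x)) => e /cs[n0 hn]; exists n0 => n k n0n n0k.
  apply: le_trans (hn n k n0n n0k).
  apply: le_trans (rnormsq_ge m_gt0 x (ell2_sub m_gt0 (ss n) (ss k))).
  rewrite ler_wpM2r ?(ltW (m_gt0 x))// /sqn /=.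
  by case: (s n x) => a b; case: (s k x) => c d /=; rewrite lerDr sqr_ge0.
pose w x := limn (fun n => complex.Re (s n x)) +i* limn (fun n => complex.Im (s n x)).
have key (e : R) : 0 < e -> exists n0, forall n, (n0 <= n)%N ->
    ell2 m (s n \- w) /\ N (s n \- w) <= e.
  move=> /cs[n0 hn]; exists n0 => n n0n.
  apply: ell2_le_finite => // A.
  have l : \sum_(x <- A) sqn ((s n \- s k) x) * m x @[k --> \oo] -->
      \sum_(x <- A) sqn ((s n \- w) x) * m x.
    apply: cvg_rsum => x; apply: cvgM; last exact: cvg_cst.
    have e1 z z' : sqn (z - z') =
        (complex.Re z - complex.Re z') * (complex.Re z - complex.Re z') +
        (complex.Im z - complex.Im z') * (complex.Im z - complex.Im z').
      by case: z => a b; case: z' => c d.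
    have dRe : complex.Re (s n x) - complex.Re (s k x) @[k --> \oo] -->
        complex.Re (s n x) - complex.Re (w x).
      by apply: cvgB; [exact: cvg_cst|exact: cRe].
    have dIm : complex.Im (s n x) - complex.Im (s k x) @[k --> \oo] -->
        complex.Im (s n x) - complex.Im (w x).
      by apply: cvgB; [exact: cvg_cst|exact: cIm].
    rewrite /= e1; under eq_cvg do rewrite /= e1.
    exact: cvgD (cvgM dRe dRe) (cvgM dIm dIm).
  apply: (cvgr_to_le l); near=> k.
  apply: le_trans (hn n k n0n _); last by near: k; exists n0.
  by apply: sum_le_rnormsq => //; exact: ell2_sub.
have [n1 h1] := key 1 ltr01.
have well : ell2 m w.
  rewrite (_ : w = s n1 \- (s n1 \- w)); last first.
    by apply/funext => x /=; ring.
  by apply: ell2_sub => //; exact: (h1 n1 (leqnn _)).1.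
exists w => //; apply/cvgrPdist_le => e /key[n0 hn]; exists n0 => // n /= n0n.
by rewrite sub0r normrN ger0_norm ?rnormsq_ge0// (hn n n0n).2.
Unshelve. all: by end_near. Qed.

End Limits.

(** * Integrals of complex functions *)

Section ComplexIntegral.
Context d (T : measurableType d) (R : realType).
Implicit Types (f g h : T -> R[i]) (mu : {finite_measure set T -> \bar R}).

Definition cmeas f :=
  measurable_fun [set: T] (fun s => complex.Re (f s)) /\
  measurable_fun [set: T] (fun s => complex.Im (f s)).

Definition cintegrable (mu : set T -> \bar R) f :=
  mu.-integrable [set: T] (EFin \o (fun s => complex.Re (f s))) /\
  mu.-integrable [set: T] (EFin \o (fun s => complex.Im (f s))).

Definition cint (mu : set T -> \bar R) f : R[i] :=
  fine (\int[mu]_s (complex.Re (f s))%:E)%E +i*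
  fine (\int[mu]_s (complex.Im (f s))%:E)%E.

Definition sqintegrable (mu : set T -> \bar R) f :=
  cmeas f /\ (\int[mu]_s (sqn (f s))%:E < +oo)%E.

Definition cind (A : set T) (s : T) : R[i] := (\1_A s : R)%:C.

Lemma cmeasM f g : cmeas f -> cmeas g -> cmeas (fun s => f s * g s).
Proof.
move=> [f1 f2] [g1 g2]; split.
  under eq_fun do rewrite ReM.
  by apply: measurable_funB; exact: measurable_funM.
under eq_fun do rewrite ImM.
by apply: measurable_funD; exact: measurable_funM.
Qed.

Lemma cmeasD f g : cmeas f -> cmeas g -> cmeas (fun s => f s + g s).
Proof.
move=> [f1 f2] [g1 g2]; split.
  by under eq_fun do rewrite ReD; exact: measurable_funD.
by under eq_fun do rewrite ImD; exact: measurable_funD.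
Qed.

Lemma cmeas_real (f : T -> R) : measurable_fun [set: T] f ->
  cmeas (fun s => (f s)%:C).
Proof. by move=> mf; split => //=; exact: measurable_cst. Qed.

Lemma cmeas_cst (a : R[i]) : cmeas (fun=> a).
Proof. by split; exact: measurable_cst. Qed.

Lemma cmeas_conj f : cmeas f -> cmeas (fun s => (f s)^*).
Proof.
move=> [f1 f2]; split; first by under eq_fun do rewrite Reconj.
by under eq_fun do rewrite Imconj; exact: measurable_funN.
Qed.

Lemma cmeas_cind (A : set T) : measurable A -> cmeas (cind A).
Proof. by move=> mA; apply: cmeas_real; exact: measurable_indic. Qed.

Lemma measurable_sqn f : cmeas f -> measurable_fun [set: T] (fun s => sqn (f s)).
Proof.
move=> [f1 f2]; rewrite /sqn.
by apply: measurable_funD; exact: measurable_funX.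
Qed.

Lemma cintegrable_le mu f (g : T -> R) : cmeas f ->
  mu.-integrable [set: T] (EFin \o g) ->
  (forall s, `|complex.Re (f s)| <= g s) ->
  (forall s, `|complex.Im (f s)| <= g s) -> cintegrable mu f.
Proof.
move=> [f1 f2] gi fg1 fg2; split.
  apply: (le_integrable measurableT _ _ gi) => [|s _].
    exact/measurable_EFinP.
  by rewrite /= lee_fin (le_trans (fg1 s))// ler_norm.
apply: (le_integrable measurableT _ _ gi) => [|s _].
  exact/measurable_EFinP.
by rewrite /= lee_fin (le_trans (fg2 s))// ler_norm.
Qed.

Lemma sqintegrableP mu f : cmeas f ->
  sqintegrable mu f <-> mu.-integrable [set: T] (EFin \o (fun s => sqn (f s))).
Proof.
move=> mf; split.
  move=> [_ fi]; apply/integrableP; split.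
    by apply/measurable_EFinP; exact: measurable_sqn.
  by under eq_integral do rewrite /= ger0_norm ?sqn_ge0//.
move=> /integrableP[_ fi]; split=> //.
by move: fi; under eq_integral do rewrite /= ger0_norm ?sqn_ge0//.
Qed.

Lemma sqintegrable_le mu f (g : T -> R) : cmeas f ->
  mu.-integrable [set: T] (EFin \o g) ->
  (forall s, sqn (f s) <= g s) -> sqintegrable mu f.
Proof.
move=> mf gi fg; apply/sqintegrableP => //.
apply: (le_integrable measurableT _ _ gi) => [|s _].
  by apply/measurable_EFinP; exact: measurable_sqn.
by rewrite /= lee_fin ger0_norm ?sqn_ge0// (le_trans (fg s))// ler_norm.
Qed.

Lemma sqintegrable_bounded mu f (M : R) : cmeas f ->
  (forall s, sqn (f s) <= M) -> sqintegrable mu f.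
Proof.
move=> mf; apply: sqintegrable_le => //.
exact: (finite_measure_integrable_cst mu M measurableT).
Qed.

Lemma integrable_sqnD mu f g : sqintegrable mu f -> sqintegrable mu g ->
  mu.-integrable [set: T] (EFin \o (fun s => sqn (f s) + sqn (g s))).
Proof.
move=> /[dup][[mf _]] /(sqintegrableP _ mf) fi.
move=> /[dup][[mg _]] /(sqintegrableP _ mg) gi.
exact: (integrableD measurableT fi gi).
Qed.

Lemma cintegrableM mu f g : sqintegrable mu f -> sqintegrable mu g ->
  cintegrable mu (fun s => f s * g s).
Proof.
move=> fi gi; apply: (cintegrable_le _ (integrable_sqnD fi gi)).
- by apply: cmeasM; [case: fi|case: gi].
- by move=> s; exact: ReM_le.
- by move=> s; exact: ImM_le.
Qed.

Lemma sqintegrable_conj mu f : sqintegrable mu f ->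
  sqintegrable mu (fun s => (f s)^*).
Proof.
move=> [mf fi]; split; first exact: cmeas_conj.
by under eq_integral do rewrite sqn_conj.
Qed.

Lemma sqintegrable_cst mu (a : R[i]) : sqintegrable mu (fun=> a).
Proof. by apply: (@sqintegrable_bounded _ _ (sqn a)) => //; exact: cmeas_cst. Qed.

Lemma sqintegrable_lin mu (a : R[i]) f g : sqintegrable mu f -> sqintegrable mu g ->
  sqintegrable mu (fun s => a * f s + g s).
Proof.
move=> fi gi; have [mf _] := fi; have [mg _] := gi.
apply: (@sqintegrable_le _ _ (fun s => 2 * sqn a * sqn (f s) + 2 * sqn (g s))).
- by apply: cmeasD => //; apply: cmeasM => //; exact: cmeas_cst.
- move: fi gi => /(sqintegrableP _ mf) fi /(sqintegrableP _ mg) gi.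
  exact: (integrableD measurableT (integrableZl measurableT (2 * sqn a) fi)
    (integrableZl measurableT 2 gi)).
- by move=> s; exact: sqn_lin_le.
Qed.

Lemma cintegrable_lin mu (a : R[i]) f g : cintegrable mu f -> cintegrable mu g ->
  cintegrable mu (fun s => a * f s + g s).
Proof.
move=> [f1 f2] [g1 g2]; split.
  rewrite [X in integrable _ _ X](_ : _ = (fun s =>
    ((complex.Re a)%:E * (complex.Re (f s))%:E +
     (- complex.Im a)%:E * (complex.Im (f s))%:E + (complex.Re (g s))%:E)%E)).
    exact: (integrableD measurableT (integrableD measurableT
      (integrableZl measurableT _ f1) (integrableZl measurableT _ f2)) g1).
  by apply/funext => s; rewrite /= ReD ReM -!EFinM -!EFinD mulNr.
rewrite [X in integrable _ _ X](_ : _ = (fun s =>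
  ((complex.Re a)%:E * (complex.Im (f s))%:E +
   (complex.Im a)%:E * (complex.Re (f s))%:E + (complex.Im (g s))%:E)%E)).
  exact: (integrableD measurableT (integrableD measurableT
    (integrableZl measurableT _ f2) (integrableZl measurableT _ f1)) g2).
by apply/funext => s; rewrite /= ImD ImM -!EFinM -!EFinD.
Qed.

Let cintE mu f : cint mu f =
  (\int[mu]_s complex.Re (f s)) +i* (\int[mu]_s complex.Im (f s)).
Proof. by []. Qed.

Lemma cint_lin mu (a : R[i]) f g : cintegrable mu f -> cintegrable mu g ->
  cint mu (fun s => a * f s + g s) = a * cint mu f + cint mu g.
Proof.
move=> [f1 f2] [g1 g2].
have lin2 (p q : R) (h k : T -> R) : mu.-integrable setT (EFin \o h) ->
    mu.-integrable setT (EFin \o k) ->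
    \int[mu]_s (p * h s + q * k s) = p * \int[mu]_s h s + q * \int[mu]_s k s
    /\ mu.-integrable setT (EFin \o (fun s => p * h s + q * k s)).
  move=> hi ki; have := integrableZl measurableT p hi.
  have := integrableZl measurableT q ki => hi' ki'; split.
    by rewrite (RintegralD measurableT)//
      (RintegralZl _ measurableT hi) (RintegralZl _ measurableT ki).
  exact: (integrableD measurableT ki' hi').
rewrite !cintE; apply: complex_eq => /=.
  under eq_Rintegral do rewrite ReD ReM -mulNr.
  have [e i] := lin2 (complex.Re a) (- complex.Im a) _ _ f1 f2.
  rewrite (RintegralD measurableT i g1) e mulNr.
  by case: (a) => p q.
under eq_Rintegral do rewrite ImD ImM.
have [e i] := lin2 (complex.Re a) (complex.Im a) _ _ f2 f1.
by rewrite (RintegralD measurableT i g2) e; case: (a) => p q.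
Qed.

Lemma cint_ind mu (A : set T) : measurable A ->
  cint mu (cind A) = (fine (mu A))%:C.
Proof.
move=> mA; rewrite !cintE; apply: complex_eq => /=.
  by rewrite /Rintegral integral_indic// setIT.
by rewrite /Rintegral integral0_eq.
Qed.

Lemma sqintegrable_cind mu (A : set T) : measurable A -> sqintegrable mu (cind A).
Proof.
move=> mA; apply: (@sqintegrable_bounded _ _ 1); first exact: cmeas_cind.
move=> s; rewrite /cind sqn_real indicE.
by case: (_ \in _); rewrite ?expr1n// expr0n.
Qed.

Lemma conj_cind (A : set T) s : (cind A s)^* = cind A s.
Proof. by rewrite /cind conjE /= oppr0. Qed.

Lemma cint0 mu : cint mu (fun=> 0) = 0.
Proof. by apply: complex_eq; rewrite /= integral0_eq. Qed.

Lemma cintegrable_cind mu (A : set T) : measurable A -> cintegrable mu (cind A).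
Proof.
move=> mA; have := cintegrableM (sqintegrable_cind mu mA) (sqintegrable_cst mu 1).
by congr cintegrable; apply/funext => s; rewrite mulr1.
Qed.

Lemma cvg_Rintegral mu (f_ : nat -> T -> R) (f g : T -> R) :
  (forall n, measurable_fun [set: T] (f_ n)) ->
  (forall s, f_ n s @[n --> \oo] --> f s) ->
  mu.-integrable [set: T] (EFin \o g) ->
  (forall n s, `|f_ n s| <= g s) ->
  \int[mu]_s f_ n s @[n --> \oo] --> \int[mu]_s f s.
Proof.
move=> mf cf gi fg.
have mlim : measurable_fun [set: T] f.
  by apply: (measurable_fun_cvg mf) => s _; exact: cf.
have := @dominated_cvg _ _ _ mu _ measurableT (fun n s => (f_ n s)%:E)
  (EFin \o f) (EFin \o g).
move=> h; apply: (@fine_cvg _ _ _ _ (fun n => \int[mu]_s (f_ n s)%:E)%E).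
rewrite fineK.
  apply: h => //.
  - by move=> n; apply/measurable_EFinP.
  - by move=> s _; apply: cvg_EFin; [near=> n|exact: cf].
  - by move=> n s _ /=; rewrite lee_fin.
apply: integrable_fin_num => //.
apply: (le_integrable measurableT _ _ gi); first exact/measurable_EFinP.
move=> s _ /=; rewrite lee_fin.
apply: le_trans (ler_norm _).
apply: (cvgr_to_le (cvg_norm (cf s))); near=> n; exact: fg.
Unshelve. all: by end_near. Qed.

Lemma cvg_cint mu (f_ : nat -> T -> R[i]) f (g : T -> R) :
  (forall n, cmeas (f_ n)) ->
  (forall s, complex.Re (f_ n s) @[n --> \oo] --> complex.Re (f s)) ->
  (forall s, complex.Im (f_ n s) @[n --> \oo] --> complex.Im (f s)) ->
  mu.-integrable [set: T] (EFin \o g) ->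
  (forall n s, `|complex.Re (f_ n s)| <= g s) ->
  (forall n s, `|complex.Im (f_ n s)| <= g s) ->
  complex.Re (cint mu (f_ n)) @[n --> \oo] --> complex.Re (cint mu f) /\
  complex.Im (cint mu (f_ n)) @[n --> \oo] --> complex.Im (cint mu f).
Proof.
move=> mf fr fi gi fgr fgi; split; apply: (cvg_Rintegral _ _ gi) => // n;
  by have [] := mf n.
Qed.

End ComplexIntegral.

Arguments cind {d T R} A s.

(** * Limits of complex sequences *)

Section ComplexLimits.
Variable R : realType.
Implicit Types (z w : nat -> R[i]) (l k : R[i]).

Definition ccvg z l :=
  complex.Re (z n) @[n --> \oo] --> complex.Re l /\
  complex.Im (z n) @[n --> \oo] --> complex.Im l.

Lemma ccvg_cst l : ccvg (fun=> l) l.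
Proof. by split; exact: cvg_cst. Qed.

Lemma ccvgD z w l k : ccvg z l -> ccvg w k -> ccvg (fun n => z n + w n) (l + k).
Proof.
move=> [z1 z2] [w1 w2]; split.
  by rewrite ReD; under eq_cvg do rewrite ReD; exact: cvgD.
by rewrite ImD; under eq_cvg do rewrite ImD; exact: cvgD.
Qed.

Lemma ccvgM z w l k : ccvg z l -> ccvg w k -> ccvg (fun n => z n * w n) (l * k).
Proof.
move=> [z1 z2] [w1 w2]; split.
  rewrite ReM; under eq_cvg do rewrite ReM.
  by apply: cvgB; exact: cvgM.
rewrite ImM; under eq_cvg do rewrite ImM.
by apply: cvgD; exact: cvgM.
Qed.

Lemma ccvg_conj z l : ccvg z l -> ccvg (fun n => (z n)^*) (l^*).
Proof.
move=> [z1 z2]; split.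
  by rewrite Reconj; under eq_cvg do rewrite Reconj.
by rewrite Imconj; under eq_cvg do rewrite Imconj; exact: cvgN.
Qed.

Lemma ccvg_sum (I : Type) (s : seq I) (z : I -> nat -> R[i]) (l : I -> R[i]) :
  (forall i, ccvg (z i) (l i)) ->
  ccvg (fun n => \sum_(i <- s) z i n) (\sum_(i <- s) l i).
Proof.
move=> zl; elim: s => [|i s IH].
  by rewrite big_nil; under eq_fun do rewrite big_nil; exact: ccvg_cst.
by rewrite big_cons; under eq_fun do rewrite big_cons; exact: ccvgD.
Qed.

Lemma ccvg_unique z l k : ccvg z l -> ccvg z k -> l = k.
Proof.
move=> [z1 z2] [w1 w2]; apply: complex_eq.
  exact: (cvg_unique _ z1 w1).
exact: (cvg_unique _ z2 w2).
Qed.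

End ComplexLimits.

(** * Measures of a projection-valued measure *)

Section SpectralMeasure.
Variables (R : realType) (X : countType) (m : X -> R).
Hypothesis m_gt0 : forall x, 0 < m x.
Variable P : set R -> (X -> R[i]) -> (X -> R[i]).
Hypothesis pvmP : projection_valued_measure m P.
Implicit Types (u v w : X -> R[i]) (a b : R[i]) (A B : set R) (f g : R -> R[i]).
Local Notation N := (rnormsq m).

Lemma P_ell2 A u : measurable A -> ell2 m u -> ell2 m (P A u).
Proof. by case: pvmP => h *; exact: h. Qed.

Lemma P_lin A a u v : measurable A -> ell2 m u -> ell2 m v ->
  P A ((a \*o u) \+ v) = (a \*o P A u) \+ P A v.
Proof. by case: pvmP => _ h *; exact: h. Qed.

Lemma P_sym A u v : measurable A -> ell2 m u -> ell2 m v ->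
  inner m (P A u) v = inner m u (P A v).
Proof. by case: pvmP => _ _ h *; exact: h. Qed.

Lemma P_cap A B u : measurable A -> measurable B -> ell2 m u ->
  P (A `&` B) u = P A (P B u).
Proof. by case: pvmP => _ _ _ h *; exact: h. Qed.

Lemma P_setT u : ell2 m u -> P setT u = u.
Proof. by case: pvmP => _ _ _ _ [h _]; exact: h. Qed.

Lemma P_add A u v : measurable A -> ell2 m u -> ell2 m v ->
  P A (u \+ v) = P A u \+ P A v.
Proof.
move=> mA us vs; have := P_lin 1 mA us vs.
have e w w' : (1 \*o w) \+ w' = w \+ w' :> (X -> R[i]).
  by apply/funext => x /=; rewrite mul1r.
by rewrite !e.
Qed.

Lemma P_sub A u v : measurable A -> ell2 m u -> ell2 m v ->
  P A (u \- v) = P A u \- P A v.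
Proof.
move=> mA us vs; have := P_lin (-1) mA vs us.
have e w w' : ((-1) \*o w) \+ w' = w' \- w :> (X -> R[i]).
  by apply/funext => x /=; ring.
by rewrite !e.
Qed.

Lemma P_scale A a u : measurable A -> ell2 m u -> P A (a \*o u) = a \*o P A u.
Proof.
move=> mA us; have us' := ell2_scale m_gt0 a us.
have := P_sub mA us us; have := P_lin a mA us (ell2_sub m_gt0 us us).
rewrite (_ : _ \+ _ = a \*o u); last by apply/funext => x /=; ring.
by move=> -> ->; apply/funext => x /=; ring.
Qed.

(** The default value 0 outside the space makes this a measure for every u,
    so that the measure structure can be attached to the function itself. *)
Definition specmu u : set R -> \bar R :=
  if pselect (ell2 m u) then spectral_mu m P u else fun=> 0%E.

Lemma specmuE u : ell2 m u -> spectral_mu m P u = specmu u.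
Proof. by move=> us; rewrite /specmu; case: pselect. Qed.

Lemma specmu_rnormsq u A : ell2 m u -> measurable A -> specmu u A = (N (P A u))%:E.
Proof.
by move=> us mA; rewrite -specmuE// /spectral_mu normsq_fin//; exact: P_ell2.
Qed.

Let specmu_ge0 u A : (0 <= specmu u A)%E.
Proof.
rewrite /specmu; case: pselect => // us; rewrite /spectral_mu.
apply: esum_ge0 => x _; rewrite lee_fin mulr_ge0 ?(ltW (m_gt0 x))//.
by rewrite sqnE; exact: sqn_ge0.
Qed.

Let specmu_sigma_additive u : semi_sigma_additive (specmu u).
Proof.
rewrite /specmu; case: pselect => us.
  by case: pvmP => _ _ _ _ [_ h]; exact: h.
move=> F _ _ _ /=; rewrite (_ : (fun=> _) = fun=> 0%E); first exact: cvg_cst.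
by apply/funext => n; rewrite big1.
Qed.

Let specmu0 u : specmu u set0 = 0%E.
Proof.
have [us|us] := pselect (ell2 m u); last by rewrite /specmu; case: pselect.
have P0 : P set0 (u \- u) = fun=> 0.
  by rewrite P_sub//; apply/funext => x /=; ring.
have h : (\sum_(0 <= i < n) specmu u set0)%E @[n --> \oo] --> specmu u set0.
  have := @specmu_sigma_additive u (fun=> set0) (fun=> measurable0)
    (@trivIset_set0 _ _ setT).
  by rewrite bigcup0//; apply.
rewrite (specmu_rnormsq us measurable0) in h *; set c := N _ in h *.
have e n : fine (\sum_(0 <= i < n) c%:E)%E = n%:R * c.
  by rewrite big_mkord sumEFin /= big_const_ord iter_addr addr0 mulr_natl.
have {}h : n%:R * c @[n --> \oo] --> c.
  have h2 := fine_cvg h _.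
  by under eq_cvg do rewrite -e; exact: h2.
have h' : n.+1%:R * c @[n --> \oo] --> c.
  by have := cvg_comp _ _ (cvg_addnr 1) h; under eq_cvg do rewrite /= addn1.
have : n.+1%:R * c - n%:R * c @[n --> \oo] --> c - c by exact: cvgB.
under eq_cvg do rewrite -mulrBl -natrB// subSnn mul1r.
rewrite subrr => h0; congr EFin.
by apply: (cvg_unique _ _ h0) => //; exact: cvg_cst.
Qed.

HB.instance Definition _ u := isMeasure.Build _ R R (specmu u)
  (specmu0 u) (specmu_ge0 u) (@specmu_sigma_additive u).

Let specmu_fin u : fin_num_fun (specmu u).
Proof.
move=> A mA; have [us|us] := pselect (ell2 m u); first by rewrite specmu_rnormsq.
by rewrite /specmu; case: pselect.
Qed.

HB.instance Definition _ u := Measure_isFinite.Build _ R R (specmu u)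
  (specmu_fin u).

(** The parallelogram law for the vectors P(A) u and P(A) v is an identity
    between measures. *)
Lemma integral_parallelogram u v (h : R -> R) : ell2 m u -> ell2 m v ->
  measurable_fun [set: R] h -> (forall s, 0 <= h s) ->
  (\int[specmu (u \+ v)%R]_s (h s)%:E + \int[specmu (u \- v)%R]_s (h s)%:E =
   2%:E * \int[specmu u]_s (h s)%:E + 2%:E * \int[specmu v]_s (h s)%:E)%E.
Proof.
move=> us vs mh h0.
have mh' : measurable_fun [set: R] (EFin \o h) by exact/measurable_EFinP.
have h0' s : [set: R] s -> (0 <= (h s)%:E)%E by rewrite lee_fin.
have two0 : (0 <= 2 :> R) by [].
rewrite -(ge0_integral_measure_add _ _ measurableT h0' mh').
rewrite -!(ge0_integral_mscale _ measurableT (NngNum two0) mh' h0').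
rewrite -(ge0_integral_measure_add _ _ measurableT h0' mh').
apply: eq_measure_integral => A mA _.
rewrite /measure_add /= /msum !big_ord_recl !big_ord0 /= /mscale /=.
rewrite !adde0 !specmu_rnormsq//; [|exact: ell2_sub|exact: ell2_add].
rewrite P_add// P_sub// -!EFinM -!EFinD; congr EFin.
by apply: parallelogram => //; exact: P_ell2.
Qed.

Lemma integral_scale a u (h : R -> R) : ell2 m u ->
  measurable_fun [set: R] h -> (forall s, 0 <= h s) ->
  (\int[specmu (a \*o u)%R]_s (h s)%:E = (sqn a)%:E * \int[specmu u]_s (h s)%:E)%E.
Proof.
move=> us mh h0.
have mh' : measurable_fun [set: R] (EFin \o h) by exact/measurable_EFinP.
have h0' s : [set: R] s -> (0 <= (h s)%:E)%E by rewrite lee_fin.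
rewrite -(ge0_integral_mscale _ measurableT (NngNum (sqn_ge0 a)) mh' h0').
apply: eq_measure_integral => A mA _; rewrite /mscale /=.
rewrite !specmu_rnormsq//; last exact: ell2_scale.
rewrite P_scale// (rnormsq_scale m_gt0 _ (P_ell2 mA us)) EFinM.
by rewrite -(specmu_rnormsq us mA).
Qed.

(** * The sesquilinear form of a function *)

Lemma spectral_domP f u : cmeas f ->
  spectral_dom m P f u <-> ell2 m u /\ sqintegrable (specmu u) f.
Proof.
move=> mf; rewrite /spectral_dom /=.
have e (mu : set R -> \bar R) :
    (\int[mu]_s (complex.Re (`|f s| ^+ 2))%:E = \int[mu]_s (sqn (f s))%:E)%E.
  by congr integral; apply/funext => s; rewrite sqnE.
split=> -[us].
  by rewrite specmuE// e => fi; split.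
by move=> [_ fi]; split=> //; rewrite specmuE// e.
Qed.

Lemma sqintegrable_specmu_add f u v : ell2 m u -> ell2 m v ->
  sqintegrable (specmu u) f -> sqintegrable (specmu v) f ->
  sqintegrable (specmu (u \+ v)) f.
Proof.
move=> us vs [mf fu] [_ fv]; split; first exact: mf.
have h : (\int[specmu (u \+ v)%R]_s (sqn (f s))%:E <=
    2%:E * \int[specmu u]_s (sqn (f s))%:E + 2%:E * \int[specmu v]_s (sqn (f s))%:E)%E.
  rewrite -integral_parallelogram//; last 2 first.
  - exact: measurable_sqn.
  - by move=> s; exact: sqn_ge0.
  by rewrite leeDl// integral_ge0// => s _; rewrite lee_fin sqn_ge0.
apply: (le_lt_trans h).
have fin w : (\int[specmu w]_s (sqn (f s))%:E < +oo)%E ->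
    (\int[specmu w]_s (sqn (f s))%:E)%E \is a fin_num.
  move=> fw; rewrite ge0_fin_numE// integral_ge0// => s _.
  by rewrite lee_fin sqn_ge0.
rewrite -(fineK (fin _ fu)) -(fineK (fin _ fv)) -!EFinM -EFinD.
exact: ltry.
Qed.

Lemma sqintegrable_specmu_scale f a u : ell2 m u ->
  sqintegrable (specmu u) f -> sqintegrable (specmu (a \*o u)) f.
Proof.
move=> us [mf fu]; split; first exact: mf.
rewrite integral_scale//; last 2 first.
- exact: measurable_sqn.
- by move=> s; exact: sqn_ge0.
have fin : (\int[specmu u]_s (sqn (f s))%:E)%E \is a fin_num.
  by rewrite ge0_fin_numE// integral_ge0// => s _; rewrite lee_fin sqn_ge0.
by rewrite -(fineK fin) -EFinM ltry.
Qed.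

(** The four vectors of the polarization formula, for k < 4. *)
Definition pol (k : nat) v u : X -> R[i] := v \+ ('i%C ^+ k \*o u).

Lemma ell2_pol k v u : ell2 m v -> ell2 m u -> ell2 m (pol k v u).
Proof. by move=> vs us; apply: ell2_add => //; exact: ell2_scale. Qed.

Lemma sqintegrable_pol f k v u : ell2 m v -> ell2 m u ->
  sqintegrable (specmu v) f -> sqintegrable (specmu u) f ->
  sqintegrable (specmu (pol k v u)) f.
Proof.
move=> vs us fv fu; have ius := ell2_scale m_gt0 ('i%C ^+ k) us.
apply: (sqintegrable_specmu_add vs ius fv).
exact: (sqintegrable_specmu_scale _ us fu).
Qed.

Lemma spectral_formE f u : ell2 m u -> spectral_form m P f u = cint (specmu u) f.
Proof. by move=> us; rewrite /spectral_form specmuE. Qed.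

Local Notation B f v u := (spectral_sesquiform m P f v u).

Lemma sesquiformE f v u : ell2 m v -> ell2 m u ->
  B f v u = 4^-1 * \sum_(k < 4) (- 'i%C) ^+ k * cint (specmu (pol k v u)) f.
Proof.
move=> vs us; rewrite /spectral_sesquiform; congr (_ * _).
by apply: eq_bigr => k _; rewrite spectral_formE//; exact: ell2_pol.
Qed.

(** Integrability against the four measures in the polarization formula is
    what makes the sesquilinear form of f linear in f. *)
Definition polintegrable f v u :=
  forall k, cintegrable (specmu (pol k v u)) f.

Lemma polintegrableM f g v u : ell2 m v -> ell2 m u ->
  sqintegrable (specmu v) f -> sqintegrable (specmu u) f ->
  sqintegrable (specmu v) g -> sqintegrable (specmu u) g ->
  polintegrable (fun s => f s * g s) v u.
Proof.
by move=> vs us *; move=> k; apply: cintegrableM; exact: sqintegrable_pol.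
Qed.

Lemma sesquiform_lin a f g v u : ell2 m v -> ell2 m u ->
  polintegrable f v u -> polintegrable g v u ->
  B (fun s => a * f s + g s) v u = a * B f v u + B g v u.
Proof.
move=> vs us fi gi; rewrite !sesquiformE// mulrCA -mulrDr; congr (_ * _).
rewrite big_distrr -big_split /=; apply: eq_bigr => k _.
by rewrite (cint_lin _ (fi k) (gi k)); ring.
Qed.

Lemma sesquiform_cind A v u : measurable A -> ell2 m v -> ell2 m u ->
  B (cind A) v u = inner m v (P A u).
Proof.
move=> mA vs us.
transitivity (inner m (P A v) (P A u)); last first.
  rewrite P_sym//; last exact: P_ell2.
  by rewrite -P_cap// setIid.
rewrite inner_polar//; try exact: P_ell2.
rewrite sesquiformE//; congr (_ * _); apply: eq_bigr => k _; congr (_ * _).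
rewrite cint_ind//= specmu_rnormsq//; last exact: ell2_pol.
rewrite /pol P_add//; last exact: ell2_scale.
by rewrite P_scale.
Qed.

(** The measure of a u is |a|^2 times the measure of u; the integral is split
    into positive and negative parts to apply the scaling of measures. *)
Lemma cint_scale f a u : ell2 m u -> cintegrable (specmu u) f ->
  cint (specmu (a \*o u)) f = (sqn a)%:C * cint (specmu u) f.
Proof.
move=> us [f1 f2].
have key (h : R -> R) : (specmu u).-integrable setT (EFin \o h) ->
    fine (\int[specmu (a \*o u)%R]_s (h s)%:E)%E =
    sqn a * fine (\int[specmu u]_s (h s)%:E)%E.
  move=> hi; have mh : measurable_fun setT h.
    by move: hi => /integrableP[/measurable_EFinP].
  have e : (\int[specmu (a \*o u)%R]_s (h s)%:E =
      (sqn a)%:E * \int[specmu u]_s (h s)%:E)%E.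
    pose p s := Num.max (h s) 0; pose q s := Num.max (- h s) 0.
    have p0 s : 0 <= p s by rewrite le_max lexx orbT.
    have q0 s : 0 <= q s by rewrite le_max lexx orbT.
    have mp : measurable_fun setT p.
      by apply: measurable_maxr => //; exact: measurable_cst.
    have mq : measurable_fun setT q.
      by apply: measurable_maxr; [exact: measurable_funN|exact: measurable_cst].
    have dec w : (\int[specmu w]_s (h s)%:E =
        \int[specmu w]_s (p s)%:E - \int[specmu w]_s (q s)%:E)%E.
      rewrite integralE; congr (_ - _)%E; apply: eq_integral => s _.
        by rewrite funeposE /p EFin_max.
      by rewrite funenegE /q EFin_max.
    have fin : ((\int[specmu u]_s (p s)%:E) +? (- \int[specmu u]_s (q s)%:E))%E.
      have := integrable_add_def measurableT hi.
      congr (_ +? - _)%E; apply: eq_integral => s _.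
        by rewrite funeposE /p EFin_max.
      by rewrite funenegE /q EFin_max.
    rewrite !dec (integral_scale a us mp p0) (integral_scale a us mq q0).
    by rewrite (muleBr _ fin).
  rewrite e fineM//; exact: integrable_fin_num.
rewrite /cint (key _ f1) (key _ f2).
by apply: complex_eq; rewrite ?ReM ?ImM /=; ring.
Qed.

(** All four vectors of the polarization are multiples (1 + i^k) u of u, and
    the weights (-i)^k |1 + i^k|^2 add up to 4. *)
Lemma sesquiform_diag f u : ell2 m u -> cintegrable (specmu u) f ->
  B f u u = cint (specmu u) f.
Proof.
move=> us fi; rewrite sesquiformE//.
have e k : pol k u u = (1 + 'i%C ^+ k) \*o u.
  by apply/funext => x; rewrite /pol /=; ring.
under eq_bigr do rewrite e cint_scale//.
rewrite !big_ord_recr big_ord0 /= /sqn !exprS !expr0.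
move: (cint _ f) => [c e'] /=.
rewrite (_ : 4^-1 = (4^-1 : R)%:C); last by rewrite fmorphV rmorph_nat.
by apply: complex_eq => /=; field.
Qed.

Lemma sesquiform_dominated (f_ : nat -> R -> R[i]) f (h : R -> R) v u :
  ell2 m v -> ell2 m u -> (forall n, cmeas (f_ n)) ->
  (forall s, ccvg (f_^~ s) (f s)) ->
  (forall k, (specmu (pol k v u)).-integrable setT (EFin \o h)) ->
  (forall n s, `|complex.Re (f_ n s)| <= h s) ->
  (forall n s, `|complex.Im (f_ n s)| <= h s) ->
  ccvg (fun n => B (f_ n) v u) (B f v u).
Proof.
move=> vs us mf cf hi h1 h2; rewrite sesquiformE//.
under eq_fun do rewrite sesquiformE//.
apply: ccvgM; first exact: ccvg_cst.
apply: ccvg_sum => k; apply: ccvgM; first exact: ccvg_cst.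
by apply: (cvg_cint mf _ _ (hi k)) => // s; have [] := cf s.
Qed.

(** Simple functions are generated together with the operators that integrate
    them; the sets need not be disjoint, since products of indicators are
    handled by P(A) P(B) = P(A `&` B). *)
Inductive simple : (R -> R[i]) -> ((X -> R[i]) -> X -> R[i]) -> Prop :=
| simple0 : simple (fun=> 0) (fun _ _ => 0)
| simpleS a A f T : measurable A -> simple f T ->
    simple (fun s => a * cind A s + f s) (fun u => (a \*o P A u) \+ T u).

Lemma simple_lin a f T g S : simple f T -> simple g S ->
  simple (fun s => a * f s + g s) (fun u => (a \*o T u) \+ S u).
Proof.
move=> fT gS; elim: fT => [|b A h U mA _ IH].
  rewrite (_ : (fun s => a * 0 + g s) = g); last by apply/funext => s; ring.
  rewrite (_ : (fun u => _) = S)//.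
  by apply/funext => u; apply/funext => x /=; ring.
have := simpleS (a * b) mA IH; congr simple.
  by apply/funext => s; ring.
by apply/funext => u; apply/funext => x /=; ring.
Qed.

Lemma simple_cmeas f T : simple f T -> cmeas f.
Proof.
elim=> [|a A g S mA _ IH]; first exact: cmeas_cst.
apply: cmeasD => //; apply: cmeasM; first exact: cmeas_cst.
exact: cmeas_cind.
Qed.

Lemma simple_sqintegrable f T u : simple f T -> sqintegrable (specmu u) f.
Proof.
elim=> [|a A g S mA _ IH]; first exact: sqintegrable_cst.
by apply: sqintegrable_lin => //; exact: sqintegrable_cind.
Qed.

Lemma simple_ell2 f T u : simple f T -> ell2 m u -> ell2 m (T u).
Proof.
move=> fT us; elim: fT => [|a A g S mA _ IH]; first exact: ell2_0.
by apply: ell2_lin => //; exact: P_ell2.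
Qed.

Lemma simple_polintegrable f T g S v u : ell2 m v -> ell2 m u ->
  simple f T -> simple g S -> polintegrable (fun s => (f s)^* * g s) v u.
Proof.
move=> vs us fT gS; apply: polintegrableM => //;
  (exact: (simple_sqintegrable _ gS) ||
   (apply: sqintegrable_conj; exact: (simple_sqintegrable _ fT))).
Qed.

Lemma cind_setI A B s : cind A s * cind B s = cind (A `&` B) s :> R[i].
Proof. by rewrite /cind indicI -rmorphM. Qed.

(** The calculus of simple functions is multiplicative: by bilinearity this
    reduces to indicators, where <P(A) u, P(B) v> = <u, P(A `&` B) v>. *)
Lemma simple_inner f T g S u v : simple f T -> simple g S ->
  ell2 m u -> ell2 m v ->
  inner m (T u) (S v) = B (fun s => (f s)^* * g s) u v.
Proof.
move=> fT gS us vs.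
have B0 : B (fun=> 0) u v = 0.
  by rewrite sesquiformE// big1 ?mulr0// => k _; rewrite cint0 mulr0.
have rank1 A : measurable A ->
    inner m (P A u) (S v) = B (fun s => (cind A s)^* * g s) u v.
  move=> mA; have Au := P_ell2 mA us.
  elim: gS => [|b A' h U mA' hU IH].
    rewrite (_ : (fun s => _) = fun=> 0); last by apply/funext => s; rewrite mulr0.
    by rewrite inner0r.
  rewrite innerDZr//; [|exact: P_ell2|exact: (simple_ell2 hU)].
  rewrite IH P_sym//; last exact: P_ell2.
  rewrite -P_cap// -sesquiform_cind//; last exact: measurableI.
  have iA w : sqintegrable (specmu w) (fun s => (cind A s)^*).
    by apply: sqintegrable_conj; exact: sqintegrable_cind.
  rewrite -sesquiform_lin//; last 2 first.
  - by move=> k; apply: cintegrable_cind; exact: measurableI.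
  - apply: polintegrableM => //; exact: (simple_sqintegrable _ hU).
  congr (B _ u v); apply/funext => s.
  by rewrite -cind_setI conj_cind; ring.
elim: fT => [|a A h U mA hU IH].
  rewrite (_ : (fun s => _) = fun=> 0); last first.
    by apply/funext => s; rewrite conjC0 mul0r.
  by rewrite inner0l//; exact: (simple_ell2 gS).
have Sv := simple_ell2 gS vs.
rewrite innerDZl//; [|exact: P_ell2|exact: (simple_ell2 hU)].
rewrite IH rank1// -sesquiform_lin//; last 2 first.
- apply: polintegrableM => //; try exact: (simple_sqintegrable _ gS);
    by apply: sqintegrable_conj; exact: sqintegrable_cind.
- exact: (simple_polintegrable _ _ hU gS).
congr (B _ u v); apply/funext => s.
by rewrite rmorphD rmorphM /=; ring.
Qed.

(** * Integrals as limits of simple functions *)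

Lemma simple_nnsfun (h : {nnsfun R >-> R}) : exists T, simple (fun s => (h s)%:C) T.
Proof.
have key (r : seq R) : exists T,
    simple (fun s => \sum_(y <- r) (y * \1_(h @^-1` [set y]) s)%:C) T.
  elim: r => [|y r [T IH]].
    exists (fun _ _ => 0); rewrite (_ : (fun _ => _) = fun=> 0); first exact: simple0.
    by apply/funext => s; rewrite big_nil.
  have my : measurable (h @^-1` [set y]) by exact: measurable_sfunP.
  exists (fun u => (y%:C \*o P (h @^-1` [set y]) u) \+ T u).
  have := simpleS y%:C my IH; congr simple; apply/funext => s.
  by rewrite big_cons rmorphM.
have [T hT] := key (fset_set (range h)); exists T.
move: hT; congr simple; apply/funext => s.
by rewrite [in RHS](fimfunE h) fsbig_finite//= rmorph_sum.
Qed.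

Lemma simple_approx_nonneg (g : R -> R) :
  measurable_fun [set: R] g -> (forall s, 0 <= g s) ->
  exists (p : nat -> R -> R) T,
    [/\ forall n, simple (fun s => (p n s)%:C) (T n),
        forall n s, 0 <= p n s <= g s &
        forall s, p n s @[n --> \oo] --> g s].
Proof.
move=> mg g0.
have mg' : measurable_fun [set: R] (EFin \o g) by exact/measurable_EFinP.
have g0' s : [set: R] s -> (0 <= (EFin \o g) s)%E by rewrite /= lee_fin.
pose h := nnsfun_approx measurableT mg'.
have [T hT] := choice (fun n => simple_nnsfun (h n)).
exists (fun n => h n), T; split => //.
- move=> n s; apply/andP; split; first by [].
  by rewrite -lee_fin /h nnsfun_approxE; exact: le_approx.
- move=> s; have h1 := @cvg_nnsfun_approx _ _ _ _ measurableT _ mg' g0' s I.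
  exact: (fine_cvg h1).
Qed.

(** The approximating sequence depends on f only, so that one sequence serves
    all the measures in a polarization formula. *)
Lemma simple_approx f : cmeas f -> exists (p : nat -> R -> R[i]) T,
  [/\ forall n, simple (p n) (T n),
      forall n s, sqn (p n s) <= sqn (f s) &
      forall s, ccvg (p^~ s) (f s)].
Proof.
move=> [mr mi].
have split_ (r : R -> R) : measurable_fun [set: R] r ->
    exists (p : nat -> R -> R) T,
    [/\ forall n, simple (fun s => (p n s)%:C) (T n),
        forall n s, p n s ^+ 2 <= r s ^+ 2 &
        forall s, p n s @[n --> \oo] --> r s].
  move=> mr'.
  have m1 : measurable_fun setT (fun s => Num.max (r s) 0).
    by apply: measurable_maxr => //; exact: measurable_cst.
  have m2 : measurable_fun setT (fun s => Num.max (- r s) 0).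
    by apply: measurable_maxr; [exact: measurable_funN|exact: measurable_cst].
  have z1 s : 0 <= Num.max (r s) 0 by rewrite le_max lexx orbT.
  have z2 s : 0 <= Num.max (- r s) 0 by rewrite le_max lexx orbT.
  have [p [T [pT pb pc]]] := simple_approx_nonneg m1 z1.
  have [q [S [qS qb qc]]] := simple_approx_nonneg m2 z2.
  exists (fun n s => p n s - q n s), (fun n u => (-1 \*o S n u) \+ T n u); split.
  - move=> n; have := simple_lin (-1) (qS n) (pT n); congr simple.
    by apply/funext => s; rewrite rmorphB /=; ring.
  - move=> n s; move: (pb n s) (qb n s); rewrite !maxEle.
    by case: ifPn => h1; case: ifPn => h2 /andP[? ?] /andP[? ?]; nra.
  - move=> s; have e : Num.max (r s) 0 - Num.max (- r s) 0 = r s.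
      by rewrite !maxEle; case: ifPn; case: ifPn; lra.
    have h := cvgB (pc s) (qc s); rewrite e in h; exact: h.
have [p [T [pT pb pc]]] := split_ _ mr.
have [q [S [qS qb qc]]] := split_ _ mi.
exists (fun n s => p n s +i* q n s), (fun n u => ('i%C \*o S n u) \+ T n u); split.
- move=> n; have := simple_lin 'i%C (qS n) (pT n); congr simple.
  by apply/funext => s; apply: complex_eq => /=; ring.
- by move=> n s; rewrite /sqn /= lerD.
- by move=> s; split; [exact: pc|exact: qc].
Qed.

(** Taking f = g in [simple_inner] gives the isometry property of the
    calculus. *)
Lemma simple_rnormsq f T u : simple f T -> ell2 m u ->
  N (T u) = \int[specmu u]_s sqn (f s).
Proof.
move=> fT us; have Tu := simple_ell2 fT us.
have fi := simple_sqintegrable u fT.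
have := simple_inner fT fT us us.
rewrite (inner_self m_gt0 Tu) sesquiform_diag//; last first.
  by apply: cintegrableM => //; exact: sqintegrable_conj.
move=> /(congr1 (@complex.Re R)) /= ->; congr fine; congr integral.
by apply/funext => s; congr EFin; rewrite ReM Reconj Imconj /sqn; ring.
Qed.

(** The strong definition of the integral of f against P at u: a limit of
    simple functions.  The value is later shown to be the one that
    [spectral_integral] chooses. *)
Definition represents f u w := exists (p : nat -> R -> R[i]) T,
  [/\ forall n, simple (p n) (T n), forall n s, sqn (p n s) <= sqn (f s),
      forall s, ccvg (p^~ s) (f s), ell2 m w &
      N (T n u \- w) @[n --> \oo] --> 0].

(** By dominated convergence the approximations are Cauchy in the L^2 space of
    the measure of u, so by the isometry their operators applied to u form a
    Cauchy sequence of vectors. *)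
Lemma represents_exists f u : ell2 m u -> sqintegrable (specmu u) f ->
  exists w, represents f u w.
Proof.
move=> us fi; have [mf _] := fi.
have [p [T [pT pb pc]]] := simple_approx mf.
have fi' := (sqintegrableP _ mf).1 fi.
pose e n : R := \int[specmu u]_s sqn (p n s - f s).
have mpf n : cmeas (fun s => -1 * f s + p n s).
  apply: cmeasD; last exact: simple_cmeas (pT n).
  by apply: cmeasM => //; exact: cmeas_cst.
have pfE n s : -1 * f s + p n s = p n s - f s by ring.
have bnd n s : sqn (p n s - f s) <= 4 * sqn (f s).
  apply: le_trans (sqnD_le _ _) _.
  rewrite sqnN.
  by move: (pb n s); lra.
have i4 : (specmu u).-integrable setT (EFin \o (fun s => 4 * sqn (f s))).
  exact: (integrableZl measurableT 4 fi').
have ei n : (specmu u).-integrable setT (EFin \o (fun s => sqn (p n s - f s))).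
  have : sqintegrable (specmu u) (fun s => -1 * f s + p n s).
    apply: (sqintegrable_le (mpf n) i4) => s.
    by rewrite pfE.
  move=> /(sqintegrableP _ (mpf n)).
  by under [X in EFin \o X]eq_fun do rewrite pfE.
have e0 : e n @[n --> \oo] --> 0.
  have -> : 0 = \int[specmu u]_s (fun=> 0) s :> R.
    by rewrite /Rintegral integral0_eq.
  apply: (cvg_Rintegral _ _ i4).
  - move=> n; have := measurable_sqn (mpf n).
    by under eq_fun do rewrite pfE.
  - move=> s; have [c1 c2] := pc s.
    have c1' : complex.Re (p n s) - complex.Re (f s) @[n --> \oo] --> 0.
      by rewrite -(subrr (complex.Re (f s))); apply: cvgB => //; exact: cvg_cst.
    have c2' : complex.Im (p n s) - complex.Im (f s) @[n --> \oo] --> 0.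
      by rewrite -(subrr (complex.Im (f s))); apply: cvgB => //; exact: cvg_cst.
    rewrite (_ : (fun n => _) = fun n =>
      (complex.Re (p n s) - complex.Re (f s)) *
        (complex.Re (p n s) - complex.Re (f s)) +
      (complex.Im (p n s) - complex.Im (f s)) *
        (complex.Im (p n s) - complex.Im (f s))); last first.
      by apply/funext => n; rewrite /sqn; case: (p n s); case: (f s).
    have h := cvgD (cvgM c1' c1') (cvgM c2' c2').
    by rewrite mul0r addr0 in h; exact: h.
  - by move=> n s; rewrite ger0_norm ?sqn_ge0.
have [||w ws cw] := @ell2_complete _ _ _ m_gt0 (fun n => T n u).
- by move=> n; exact: simple_ell2 (pT n) us.
- move=> eps eps0.
  have /cvgrPdist_le /(_ (eps / 4)) [|n0 _ hn] := e0; first by rewrite divr_gt0.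
  have {}hn n : (n0 <= n)%N -> e n <= eps / 4.
    by move=> /hn /=; rewrite sub0r normrN => /(le_trans (ler_norm _)).
  exists n0 => n k /hn n1 /hn k1.
  have := simple_rnormsq (simple_lin (-1) (pT k) (pT n)) us.
  rewrite (_ : _ \+ _ = T n u \- T k u); last by apply/funext => x /=; ring.
  move=> ->; apply: (@le_trans _ _ (2 * e n + 2 * e k)); last by lra.
  rewrite -!RintegralZl// -RintegralD//; last 2 first.
  - exact: (integrableZl measurableT 2 (ei n)).
  - exact: (integrableZl measurableT 2 (ei k)).
  apply: le_Rintegral => //.
  - apply/(sqintegrableP _ _).1; last first.
      exact: simple_sqintegrable (simple_lin (-1) (pT k) (pT n)).
    exact: simple_cmeas (simple_lin (-1) (pT k) (pT n)).
  - exact: (integrableD measurableT (integrableZl measurableT 2 (ei n))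
      (integrableZl measurableT 2 (ei k))).
  - move=> s _.
    rewrite (_ : -1 * p k s + p n s = (p n s - f s) + (- (p k s - f s))); last by ring.
    apply: le_trans (sqnD_le _ _) _.
    by rewrite sqnN.
by exists w, p, T; split.
Qed.

(** Multiplicativity of the calculus: it holds for simple functions, and both
    sides pass to the limit, the right one by dominated convergence with the
    bound |f|^2 + |g|^2. *)
Lemma represents_inner f g u v w z : ell2 m u -> ell2 m v ->
  sqintegrable (specmu u) f -> sqintegrable (specmu v) f ->
  sqintegrable (specmu u) g -> sqintegrable (specmu v) g ->
  represents f u w -> represents g v z ->
  inner m w z = B (fun s => (f s)^* * g s) u v.
Proof.
move=> us vs fu fv gu gv [p [T [pT pb pc ws cw]]] [q [S [qS qb qc zs cz]]].
have c1 : ccvg (fun n => inner m (T n u) (S n v)) (inner m w z).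
  apply: cvg_inner => //.
    by move=> n; exact: simple_ell2 (pT n) us.
  by move=> n; exact: simple_ell2 (qS n) vs.
apply: (ccvg_unique c1); under eq_fun do rewrite (simple_inner (pT _) (qS _) us vs).
apply: (@sesquiform_dominated _ _ (fun s => sqn (f s) + sqn (g s))) => //.
- move=> n; apply: cmeasM; last exact: simple_cmeas (qS n).
  by apply: cmeas_conj; exact: simple_cmeas (pT n).
- by move=> s; apply: ccvgM (qc s); exact: ccvg_conj.
- by move=> k; apply: integrable_sqnD; exact: sqintegrable_pol.
- move=> n s; apply: le_trans (ReM_le _ _) _; rewrite sqn_conj.
  exact: lerD.
- move=> n s; apply: le_trans (ImM_le _ _) _; rewrite sqn_conj.
  exact: lerD.
Qed.

Lemma represents_ell2 f u w : represents f u w -> ell2 m w.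
Proof. by case=> p [T []]. Qed.

Lemma represents_1 v : ell2 m v -> represents (fun=> 1) v v.
Proof.
move=> vs; exists (fun _ _ => 1), (fun _ u => (1 \*o P setT u) \+ (fun=> 0)); split => //.
- move=> _; have := simpleS 1 measurableT simple0; congr simple.
  by apply/funext => s; rewrite /cind indicT; apply: complex_eq => /=; ring.
- by move=> s; exact: ccvg_cst.
- rewrite (_ : (fun n => _) = fun=> 0); first exact: cvg_cst.
  apply/funext => n; rewrite P_setT// (_ : _ \- _ = 0 \*o v).
    by rewrite rnormsq_scale// sqn0 mul0r.
  by apply/funext => x /=; ring.
Qed.

(** * Identification of the spectral integral, and bounds *)

Lemma represents_rnormsq f u w : ell2 m u -> sqintegrable (specmu u) f ->
  represents f u w -> N w = \int[specmu u]_s sqn (f s).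
Proof.
move=> us fi fw; have := represents_inner us us fi fi fi fi fw fw.
rewrite (inner_self m_gt0 (represents_ell2 fw)) sesquiform_diag//; last first.
  by apply: cintegrableM => //; exact: sqintegrable_conj.
move=> /(congr1 (@complex.Re R)) /= ->; congr fine; congr integral.
by apply/funext => s; congr EFin; rewrite ReM Reconj Imconj /sqn; ring.
Qed.

(** The limit vector w satisfies the equation that characterizes the value of
    [spectral_integral], by [represents_inner] with the constant 1 for the
    left factor.  The value is unique because the indicators lie in the
    domain. *)
Lemma spectral_integral_represents f u : cmeas f ->
  (forall x, spectral_dom m P f (indicator R x)) -> spectral_dom m P f u ->
  represents f u (spectral_integral m P f u).
Proof.
move=> mf fx /(spectral_domP _ mf)[us fu].
have [w fw] := represents_exists us fu.
pose Q := [set w | ell2 m w /\ forall v, spectral_dom m P f v ->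
  inner m v w = B f v u].
have Qw : Q w.
  split; first exact: represents_ell2 fw.
  move=> v /(spectral_domP _ mf)[vs fv].
  have c1 z : sqintegrable (specmu z) (fun=> 1) by exact: sqintegrable_cst.
  rewrite (represents_inner vs us (c1 v) (c1 u) fv fu (represents_1 vs) fw).
  by congr (B _ v u); apply/funext => s; rewrite conjC1 mul1r.
have : Q (xget (fun=> 0) Q) by apply: xgetPex; exists w.
have -> : spectral_integral m P f u = xget (fun=> 0) Q by [].
move: (xget _ _) => w' [_ hw'].
have <- // : w = w'.
apply: (eq_inner_indicator m_gt0) => x.
by rewrite (Qw.2 _ (fx x)) (hw' _ (fx x)).
Qed.

Lemma inner_spectral_integral2 f g u v : cmeas f -> cmeas g ->
  (forall x, spectral_dom m P f (indicator R x)) ->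
  (forall x, spectral_dom m P g (indicator R x)) ->
  spectral_dom m P f u -> spectral_dom m P f v ->
  spectral_dom m P g u -> spectral_dom m P g v ->
  inner m (spectral_integral m P f u) (spectral_integral m P g v) =
  B (fun s => (f s)^* * g s) u v.
Proof.
move=> mf mg fx gx fu fv gu gv.
have fw := spectral_integral_represents mf fx fu.
have gz := spectral_integral_represents mg gx gv.
move: fu fv gu gv => /(spectral_domP _ mf)[us fu] /(spectral_domP _ mf)[vs fv].
move=> /(spectral_domP _ mg)[_ gu] /(spectral_domP _ mg)[_ gv].
exact: represents_inner fw gz.
Qed.

Lemma inner_spectral_integral f u v : cmeas f ->
  (forall x, spectral_dom m P f (indicator R x)) ->
  spectral_dom m P f u -> spectral_dom m P f v ->
  inner m u (spectral_integral m P f v) = B f u v.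
Proof.
move=> mf fx fu fv; have fw := spectral_integral_represents mf fx fv.
move: fu fv => /(spectral_domP _ mf)[us fu] /(spectral_domP _ mf)[vs fv].
have c1 z : sqintegrable (specmu z) (fun=> 1) by exact: sqintegrable_cst.
rewrite (represents_inner us vs (c1 u) (c1 v) fu fv (represents_1 us) fw).
by congr (B _ u v); apply/funext => s; rewrite conjC1 mul1r.
Qed.

Lemma integrable_of_sqintegrable (h : R -> R) u :
  sqintegrable (specmu u) (fun s => (h s)%:C) ->
  (specmu u).-integrable setT (EFin \o h).
Proof.
move=> hi; have [] := cintegrableM hi (sqintegrable_cst (specmu u) 1).
move=> + _; rewrite (_ : EFin \o _ = EFin \o h)//.
by apply/funext => s /=; rewrite !mulr0 subr0 mulr1.
Qed.

(** Factor g as |g|^(1/2) times g / |g|^(1/2).  The form of g is then an inner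
    product of two vectors whose squared norms are the integrals of |g|. *)
Lemma sesquiform_bound g (h : R -> R) u v : ell2 m u -> ell2 m v -> cmeas g ->
  (forall s, 0 <= h s) -> (forall s, sqn (g s) <= h s ^+ 2) ->
  (specmu u).-integrable setT (EFin \o h) ->
  (specmu v).-integrable setT (EFin \o h) ->
  `|B g u v| <=
    ((\int[specmu u]_s h s + \int[specmu v]_s h s) / 2)%:C.
Proof.
move=> us vs mg h0 gh hu hv.
(* r = |g|^(1/2), and q is its inverse, with 0 at the zeros of g. *)
pose r s : R := sqn (g s) `^ 4^-1; pose q s : R := sqn (g s) `^ (- 4^-1).
have r0 s : 0 <= r s by exact: powR_ge0.
have r4 s : r s ^+ 4 = sqn (g s).
  by rewrite /r -powR_mulrn ?powR_ge0// -powRrM mulVf// powRr1// sqn_ge0.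
have qr s : q s = (r s)^-1 by rewrite /q powRN.
have rh s : r s ^+ 2 <= h s.
  by rewrite -(@ler_pXn2r _ 2%N) ?nnegrE ?sqr_ge0// -exprM r4.
have mr : measurable_fun setT r.
  exact: measurableT_comp (measurable_powR _) (measurable_sqn mg).
have mq : measurable_fun setT q.
  exact: measurableT_comp (measurable_powR _) (measurable_sqn mg).
pose f1 s := (r s)%:C; pose f2 s := g s * (q s)%:C.
have f1s s : sqn (f1 s) = r s ^+ 2 by rewrite sqn_real.
have f2s s : sqn (f2 s) = r s ^+ 2.
  rewrite /f2 sqnM sqn_real qr -r4.
  have [->|rn0] := eqVneq (r s) 0; first by rewrite !expr0n mul0r.
  by field.
have f12 s : (f1 s)^* * f2 s = g s.
  rewrite /f1 /f2 qr conjE /= oppr0.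
  have [rs0|rn0] := eqVneq (r s) 0.
    rewrite rs0 mul0r; have := r4 s; rewrite rs0 expr0n /= /sqn => /esym/eqP.
    rewrite paddr_eq0 ?sqr_ge0// !sqrf_eq0 => /andP[/eqP g1 /eqP g2].
    exact: complex_eq.
  apply: complex_eq; rewrite !(ReM, ImM) /=; by field.
have mf1 : cmeas f1 by exact: cmeas_real.
have mf2 : cmeas f2 by apply: cmeasM => //; exact: cmeas_real.
have i1 w : (specmu w).-integrable setT (EFin \o h) -> sqintegrable (specmu w) f1.
  by move=> hw; apply: (sqintegrable_le mf1 hw) => s; rewrite f1s.
have i2 w : (specmu w).-integrable setT (EFin \o h) -> sqintegrable (specmu w) f2.
  by move=> hw; apply: (sqintegrable_le mf2 hw) => s; rewrite f2s.
have [w fw] := represents_exists us (i1 _ hu).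
have [z gz] := represents_exists vs (i2 _ hv).
have := represents_inner us vs (i1 _ hu) (i1 _ hv) (i2 _ hu) (i2 _ hv) fw gz.
rewrite (_ : (fun s => _) = g); last by apply/funext => s; rewrite f12.
move=> <-; apply: le_trans (inner_abs_le m_gt0 _ _) _.
- exact: represents_ell2 fw.
- exact: represents_ell2 gz.
rewrite lecR ler_pM2r ?invr_gt0// lerD//.
  rewrite (represents_rnormsq us (i1 _ hu) fw); apply: le_Rintegral => //.
    by have := (sqintegrableP _ mf1).1 (i1 _ hu).
  by move=> s _; rewrite f1s.
rewrite (represents_rnormsq vs (i2 _ hv) gz); apply: le_Rintegral => //.
  by have := (sqintegrableP _ mf2).1 (i2 _ hv).
by move=> s _; rewrite f2s.
Qed.

Definition negative : set R := `]-oo, 0[%classic.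

Lemma specmu_P A C u : ell2 m u -> measurable A -> measurable C ->
  specmu (P A u) C = specmu u (C `&` A).
Proof.
move=> us mA mC; rewrite !specmu_rnormsq//; last 2 first.
- exact: measurableI.
- exact: P_ell2.
by rewrite P_cap.
Qed.

(** The vector w = P(A) u lies in the domain because A is bounded.  Its form
    is the integral of s against its measure, which lives on A, where
    s <= c < 0; so it can be nonnegative only if the measure is zero. *)
Lemma specmu_bounded_negative A (b c : R) u : ell2 m u -> measurable A ->
  A `<=` `[b, c]%classic -> c < 0 ->
  (forall x, spectral_dom m P (fun s => s%:C) (indicator R x)) ->
  (forall w, spectral_dom m P (fun s => s%:C) w ->
    0 <= inner m w (spectral_integral m P (fun s => s%:C) w)) ->
  specmu u A = 0%E.
Proof.
move=> us mA Abc c0 idx pos; pose w := P A u.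
have ws : ell2 m w by exact: P_ell2.
have mid : cmeas (fun s : R => s%:C) by apply: cmeas_real.
have mCA : measurable (~` A) by exact: measurableC.
have wA : specmu w (~` A) = 0%E.
  by rewrite specmu_P// setICl measure0.
have iw : sqintegrable (specmu w) (fun s : R => s%:C).
  split => //.
  rewrite (ge0_negligible_integral mCA measurableT _ _ wA); last 2 first.
  - by apply/measurable_EFinP; exact: measurable_sqn.
  - by move=> s _; rewrite lee_fin sqn_ge0.
  rewrite setTD setCK.
  apply: (@le_lt_trans _ _ (\int[specmu w]_(s in A) (b ^+ 2)%:E)%E).
    apply: ge0_le_integral => //.
    - by move=> s _; rewrite lee_fin sqn_ge0.
    - apply: (measurable_funS measurableT) => //.
      by apply/measurable_EFinP; exact: measurable_sqn.
    - move=> s /Abc; rewrite /= in_itv /= => /andP[h1 h2].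
      by rewrite lee_fin sqn_real; nra.
  rewrite integral_cst//.
  by rewrite [X in (_ * X)%E](specmu_rnormsq ws mA) -EFinM ltry.
have dw : spectral_dom m P (fun s => s%:C) w by exact/spectral_domP.
have := pos w dw; rewrite inner_spectral_integral// sesquiform_diag//; last first.
  split; first exact: integrable_of_sqintegrable.
  by apply: (@eq_integrable _ _ _ _ _ measurableT (cst 0%E)) => //; exact: integrable0.
rewrite /cint lecE /= => /andP[_].
have iid : (specmu w).-integrable setT (EFin \o (fun s : R => s)).
  exact: integrable_of_sqintegrable.
rewrite (negligible_integral mCA measurableT iid wA) setTD setCK => ge0.
have : (\int[specmu w]_(s in A) s%:E <= \int[specmu w]_(s in A) c%:E)%E.
  apply: le_integral => //.
  - exact: (integrableS measurableT mA (@subsetT _ A) iid).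
  - exact: (finite_measure_integrable_cst (specmu w) c mA).
  - by move=> s; rewrite inE => /Abc; rewrite /= in_itv /= lee_fin => /andP[].
rewrite integral_cst// => le.
have wu : specmu w A = specmu u A by rewrite specmu_P// setIid.
have fin : (\int[specmu w]_(s in A) s%:E)%E \is a fin_num.
  apply: integrable_fin_num => //.
  exact: (integrableS measurableT mA (@subsetT _ A) iid).
move: le; rewrite -(fineK fin) [X in (_ * X)%E]wu (specmu_rnormsq us mA).
rewrite -EFinM lee_fin => le.
congr EFin; apply/eqP; rewrite eq_le rnormsq_ge0// andbT.
by have := rnormsq_ge0 m_gt0 (P A u); nra.
Qed.

Lemma specmu_negative u : ell2 m u ->
  (forall x, spectral_dom m P (fun s => s%:C) (indicator R x)) ->
  (forall w, spectral_dom m P (fun s => s%:C) w ->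
    0 <= inner m w (spectral_integral m P (fun s => s%:C) w)) ->
  specmu u negative = 0%E.
Proof.
move=> us idx pos.
pose A (k : nat) : set R := `[- k.+1%:R, - k.+1%:R^-1]%classic.
have mA k : measurable (A k) by exact: measurable_itv.
have A0 k : (specmu u).-negligible (A k).
  apply/negligibleP => //; apply: (specmu_bounded_negative us (mA k) _ _ idx pos).
    exact: subset_refl.
  by rewrite oppr_lt0 invr_gt0.
have neg : negative `<=` \bigcup_k A k.
  move=> s; rewrite /negative /= in_itv /= => s0.
  pose k := Num.truncn (- s + (- s)^-1).
  have hk := truncnS_gt (- s + (- s)^-1).
  have p1 : 0 < - s by rewrite oppr_gt0.
  have p2 : 0 < (- s)^-1 by rewrite invr_gt0.
  exists k => //; rewrite /A /= in_itv /= -/k in hk *; apply/andP; split; first lra.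
  rewrite lerNr -[leRHS]invrK lef_pV2 ?posrE ?invr_gt0//; last first.
  by lra.
apply: measure_negligible; first exact: measurable_itv.
exact: negligibleS neg (negligible_bigcup A0).
Qed.

(** * Operators with nonnegative spectrum *)

Section NonnegativeSpectrum.
Hypothesis spectrum_ge0 : forall u, ell2 m u -> specmu u negative = 0%E.

Lemma integral_eq_nonneg (h1 h2 : R -> R) u : ell2 m u ->
  measurable_fun setT h1 -> measurable_fun setT h2 ->
  (forall s, 0 <= s -> h1 s = h2 s) ->
  (\int[specmu u]_s (h1 s)%:E = \int[specmu u]_s (h2 s)%:E)%E.
Proof.
move=> us m1 m2 h12; apply: ae_eq_integral => //.
- exact/measurable_EFinP.
- exact/measurable_EFinP.
exists negative; split.
- exact: measurable_itv.
- exact: spectrum_ge0.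
move=> s /= h; rewrite /negative /= in_itv /=; apply: contrapT => /negP.
by rewrite -leNgt => s0; apply: h => _; rewrite h12.
Qed.

Lemma sesquiform_eq_nonneg f g u v : ell2 m u -> ell2 m v ->
  cmeas f -> cmeas g -> (forall s, 0 <= s -> f s = g s) -> B f u v = B g u v.
Proof.
move=> us vs [f1 f2] [g1 g2] fg; rewrite !sesquiformE//; congr (_ * _).
apply: eq_bigr => k _; congr (_ * _); rewrite /cint.
have ks := ell2_pol k us vs.
congr (fine _ +i* fine _); apply: integral_eq_nonneg => // s /fg ->//.
Qed.

Let nonnegs : set R := `[0, +oo[%classic.

Definition nonneg_cut f (s : R) : R[i] := cind nonnegs s * f s.

Let nonneg_cutE f s : nonneg_cut f s = if 0 <= s then f s else 0.
Proof.
rewrite /nonneg_cut /cind indicE mem_setE in_itv /= andbT.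
by case: ifPn; rewrite ?mul1r// mul0r.
Qed.

Let cmeas_nonneg_cut f : cmeas f -> cmeas (nonneg_cut f).
Proof. by apply: cmeasM; apply: cmeas_cind; exact: measurable_itv. Qed.

Lemma sqintegrable_nonneg f (M : R) u : ell2 m u -> cmeas f -> 0 <= M ->
  (forall s, 0 <= s -> sqn (f s) <= M) -> sqintegrable (specmu u) f.
Proof.
move=> us mf M0 fM; split=> //.
rewrite (@integral_eq_nonneg _ (fun s => sqn (nonneg_cut f s)))//.
- have [] // := @sqintegrable_bounded _ _ _ (specmu u) (nonneg_cut f) M.
    exact: cmeas_nonneg_cut.
  by move=> s; rewrite nonneg_cutE; case: ifPn => [/fM//|_]; rewrite sqn0.
- exact: measurable_sqn.
- by apply: measurable_sqn; exact: cmeas_nonneg_cut.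
- by move=> s s0; rewrite nonneg_cutE s0.
Qed.

Lemma polintegrable_sq f u v : ell2 m u -> ell2 m v ->
  sqintegrable (specmu u) f -> sqintegrable (specmu v) f -> polintegrable f u v.
Proof.
move=> us vs fu fv; have c1 z := sqintegrable_cst (specmu z) (1 : R[i]).
have := polintegrableM us vs (c1 u) (c1 v) fu fv.
by congr polintegrable; apply/funext => s; rewrite mul1r.
Qed.

Definition pw (k : nat) (s : R) : R[i] := (s ^+ k)%:C.

Lemma cmeas_pw k : cmeas (pw k).
Proof. by apply: cmeas_real; exact: measurable_funX. Qed.

(** Subtract the Taylor polynomial inside the form, and bound the form of the
    remainder by [sesquiform_bound].  The estimate of the remainder holds on
    the spectrum only, so the remainder is replaced by 0 on the negative
    half-line. *)
Lemma sesquiform_taylor f (c : nat -> R[i]) d (K : R) u v :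
  ell2 m u -> ell2 m v -> cmeas f ->
  sqintegrable (specmu u) f -> sqintegrable (specmu v) f ->
  (forall k, sqintegrable (specmu u) (pw k)) ->
  (forall k, sqintegrable (specmu v) (pw k)) -> 0 <= K ->
  (forall s, 0 <= s ->
    sqn (f s - \sum_(k < d.+1) c k * pw k s) <= (K * s ^+ d.+1) ^+ 2) ->
  `|B f u v - \sum_(k < d.+1) c k * B (pw k) u v| <=
    (K / 2)%:C * (B (pw d.+1) u u + B (pw d.+1) v v).
Proof.
move=> us vs mf fu fv pu pv K0 rem.
pose g n s := f s - \sum_(k < n) c k * pw k s.
have gS n s : g n.+1 s = - c n * pw n s + g n s.
  by rewrite /g big_ord_recr /=; ring.
have gi n : [/\ cmeas (g n), polintegrable (g n) u v &
    B (g n) u v = B f u v - \sum_(k < n) c k * B (pw k) u v].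
  elim: n => [|n [mg ig IH]].
    have -> : g 0%N = f by apply/funext => s; rewrite /g big_ord0 subr0.
    by rewrite big_ord0 subr0; split => //; exact: polintegrable_sq.
  have ip : polintegrable (pw n) u v := polintegrable_sq us vs (pu n) (pv n).
  have -> : g n.+1 = fun s => - c n * pw n s + g n s.
    by apply/funext => s; rewrite gS.
  split.
  - apply: cmeasD => //; apply: cmeasM; first exact: cmeas_cst.
    exact: cmeas_pw.
  - by move=> k; exact: cintegrable_lin (ip k) (ig k).
  - by rewrite sesquiform_lin// IH big_ord_recr /=; ring.
have [mg _ e] := gi d.+1; rewrite -[X in `|X| <= _]e.
have mg' := cmeas_nonneg_cut mg.
rewrite (sesquiform_eq_nonneg us vs mg mg'); last first.
  by move=> s s0; rewrite nonneg_cutE s0.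
pose h s : R := \1_nonnegs s * (K * s ^+ d.+1).
have hE s : h s = if 0 <= s then K * s ^+ d.+1 else 0.
  rewrite /h indicE mem_setE in_itv /= andbT.
  by case: ifPn; rewrite ?mul1r// mul0r.
have mK : measurable_fun setT (fun s : R => K * s ^+ d.+1).
  by apply: measurable_funM; [exact: measurable_cst|exact: measurable_funX].
have mh : measurable_fun setT h.
  by apply: measurable_funM => //; apply: measurable_indic; exact: measurable_itv.
have h0 s : 0 <= h s.
  by rewrite hE; case: ifPn => // s0; rewrite mulr_ge0// exprn_ge0.
have ip w : (forall k, sqintegrable (specmu w) (pw k)) ->
    (specmu w).-integrable setT (EFin \o (fun s => s ^+ d.+1)).
  by move=> wp; exact: integrable_of_sqintegrable (wp d.+1).
have ih w : (forall k, sqintegrable (specmu w) (pw k)) ->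
    (specmu w).-integrable setT (EFin \o h).
  move=> wp; apply: (le_integrable measurableT _ _
    (integrableZl measurableT K (ip w wp))); first exact/measurable_EFinP.
  move=> s _; rewrite /= lee_fin hE; case: ifPn => // _.
  by rewrite normr0.
have hK w : ell2 m w -> (forall k, sqintegrable (specmu w) (pw k)) ->
    (\int[specmu w]_s h s)%:C = K%:C * B (pw d.+1) w w.
  move=> ws wp; rewrite sesquiform_diag//; last first.
    have := cintegrableM (wp d.+1) (sqintegrable_cst (specmu w) 1).
    by congr cintegrable; apply/funext => s; rewrite mulr1.
  have -> : \int[specmu w]_s h s = K * \int[specmu w]_s (s ^+ d.+1).
    rewrite -RintegralZl//; last exact: ip.
    congr fine; apply: integral_eq_nonneg => // s s0.
    by rewrite hE s0.
  rewrite /cint; apply: complex_eq; rewrite /= ?mul0r ?subr0//.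
  by rewrite [X in fine X]integral0_eq//= mulr0 addr0.
apply: le_trans (sesquiform_bound us vs mg' h0 _ (ih u pu) (ih v pv)) _.
  move=> s; rewrite nonneg_cutE hE; case: ifPn => [/rem//|_].
  by rewrite sqn0 expr0n.
rewrite rmorphM rmorphD /= (hK u us pu) (hK v vs pv).
by rewrite rmorphM /= -mulrDr mulrAC.
Qed.

End NonnegativeSpectrum.

End SpectralMeasure.

(** * Taylor remainders of exponentials *)

Section Taylor.
Variable R : realType.
Implicit Types (c : nat -> R) (r a b : R).

(** Taylor polynomials with the factorials outside of the coefficients, so that
    differentiation is a shift of c. *)
Definition tpoly c n r := \sum_(k < n) c k * (r ^+ k / k`!%:R).

Lemma is_derive_congr (f g : R -> R) r a b :
  is_derive r 1 f a -> f =1 g -> a = b -> is_derive r 1 g b.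
Proof. by move=> fa /funext <- <-. Qed.

Lemma is_derive_monomial n r :
  is_derive r 1 (fun r => r ^+ n.+1 / n.+1`!%:R) (r ^+ n / n`!%:R).
Proof.
have h := is_deriveX n.+1 (is_derive_id r (1 : R)).
apply: is_derive_congr (is_deriveZ (n.+1`!%:R^-1) h) _ _ => [s|].
  rewrite /GRing.scale /= mulrC; congr (_ * _).
  by elim: (n.+1) => // k IH; rewrite !exprS -IH.
rewrite /GRing.scale /= mulr1 factS natrM.
by rewrite invfM mulrA [X in X * _]mulrAC mulVf ?pnatr_eq0// mul1r mulrC.
Qed.

Lemma is_derive_tpoly c n r :
  is_derive r 1 (tpoly c n.+1) (tpoly (c \o S) n r).
Proof.
elim: n => [|n IH].
  apply: is_derive_congr (is_derive_cst (c 0%N) r 1) _ _ => [s|].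
    by rewrite /tpoly big_ord1 expr0 fact0 divr1 mulr1.
  by rewrite /tpoly big_ord0.
have h := is_deriveZ (c n.+1) (is_derive_monomial n r).
apply: is_derive_congr (is_deriveD IH h) _ _ => [s|].
  by rewrite /tpoly [in RHS]big_ord_recr.
by rewrite /tpoly [in RHS]big_ord_recr.
Qed.

Lemma tpoly_at0 c n : tpoly c n.+1 0 = c 0%N.
Proof.
rewrite /tpoly big_ord_recl /= expr0 fact0 divr1 mulr1 big1 ?addr0// => k _.
by rewrite expr0n /= mul0r mulr0.
Qed.

Lemma ge0_of_derive (f df : R -> R) r : 0 <= r ->
  (forall s : R, is_derive s 1 f (df s)) -> (forall s, 0 <= s -> 0 <= df s) ->
  f 0 = 0 -> 0 <= f r.
Proof.
move=> r0 fd df0 f0.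
have [|s] := @MVT_segment _ f df 0 r r0 (fun s _ => fd s).
  apply: continuous_subspaceT => s; apply: differentiable_continuous.
  by apply/derivable1_diffP; have [] := fd s.
rewrite in_itv /= => /andP[s0 _]; rewrite f0 !subr0 => ->.
by rewrite mulr_ge0// df0.
Qed.

(** The parameter t is a direction in which the remainder is tested, and
    differentiation turns it by tau.  As the bound 1 holds in all admissible
    directions at once, it can be integrated n times. *)
Lemma iterated_bound (T : Type) (Q : T -> Prop) (tau : T -> T)
    (G : nat -> T -> R -> R) :
  (forall t, Q t -> Q (tau t)) ->
  (forall t r, Q t -> 0 <= r -> G 0%N t r <= 1) ->
  (forall n t, G n.+1 t 0 = 0) ->
  (forall n t (r : R), is_derive r 1 (G n.+1 t) (G n (tau t) r)) ->
  forall n t r, Q t -> 0 <= r -> G n t r <= r ^+ n / n`!%:R.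
Proof.
move=> Qtau G0 Gz Gd; elim=> [|n IH] t r Qt r0.
  by rewrite expr0 fact0 divr1 G0.
rewrite -subr_ge0.
apply: (@ge0_of_derive (fun r => r ^+ n.+1 / n.+1`!%:R - G n.+1 t r)
  (fun r => r ^+ n / n`!%:R - G n (tau t) r)) => //.
- move=> s; exact: (is_deriveB (is_derive_monomial n s) (Gd n t s)).
- by move=> s s0; rewrite subr_ge0 IH//; exact: Qtau.
- by rewrite Gz expr0n mul0r subr0.
Qed.

(** The directions are the two signs, exchanged by differentiation. *)
Lemma expR_remainder d r : 0 <= r ->
  (expR (- r) - \sum_(k < d) (-1) ^+ k * (r ^+ k / k`!%:R)) ^+ 2 <=
  (r ^+ d / d`!%:R) ^+ 2.
Proof.
move=> r0; pose p := fun k => (-1) ^+ k : R.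
pose G n (b : bool) r := (-1) ^+ b * (expR (- r) - tpoly p n r).
have dexp (s : R) : is_derive s 1 (fun s => expR (- s)) (- expR (- s)).
  have h := is_derive1_comp (is_derive_expR (- s)) (is_deriveN (is_derive_id s (1 : R))).
  by apply: is_derive_congr h _ _ => //; rewrite mulrN1.
have Gb n (b : bool) : G n b r <= r ^+ n / n`!%:R.
  apply: (@iterated_bound _ (fun=> True) negb G _ _ _ _ n b r I r0).
  - by [].
  - move=> {}b s _ s0; rewrite /G /tpoly big_ord0 subr0.
    have e0 := expR_ge0 (- s).
    have e1 : expR (- s) <= 1 by rewrite -expR0 ler_expR oppr_le0.
    by case: b; rewrite ?expr1 ?expr0; lra.
  - by move=> k {}b; rewrite /G tpoly_at0 oppr0 expR0 /p expr0 subrr mulr0.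
  - move=> k {}b s.
    have h := is_deriveZ ((-1) ^+ b) (is_deriveB (dexp s) (is_derive_tpoly p k s)).
    apply: is_derive_congr h _ _ => //.
    rewrite /G /GRing.scale /=.
    have -> : tpoly (p \o S) k s = - tpoly p k s.
      rewrite /tpoly -sumrN; apply: eq_bigr => i _.
      by rewrite /p /= exprS; ring.
    by case: b; rewrite ?expr1 ?expr0; ring.
have h1 := Gb d false; have h2 := Gb d true.
rewrite -[leLHS]real_normK ?num_real// ler_sqr ?nnegrE ?normr_ge0//; last first.
  by rewrite divr_ge0 ?exprn_ge0.
rewrite ler_norml; move: h1 h2; rewrite /G /tpoly /p expr0 expr1 => h1 h2.
by apply/andP; split; lra.
Qed.

(** The directions are the vectors of the closed unit disc, and differentiation
    rotates them by a quarter turn; the modulus of the remainder is its value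
    in its own direction.  This keeps the sharp constant, which separate
    bounds of the real and imaginary parts would lose. *)
Lemma cis_remainder d r : 0 <= r ->
  sqn ((cos r -i* sin r) - \sum_(k < d) (- 'i%C) ^+ k * (r ^+ k / k`!%:R)%:C) <=
  (r ^+ d / d`!%:R) ^+ 2.
Proof.
move=> r0.
pose p k : R := complex.Re ((- 'i%C : R[i]) ^+ k).
pose q k : R := complex.Im ((- 'i%C : R[i]) ^+ k).
have pS : p \o S = q.
  by apply/funext => k; rewrite /p /q /= exprS; case: (_ ^+ k) => a b /=; ring.
have qS k : q k.+1 = - p k.
  by rewrite /p /q /= exprS; case: (_ ^+ k) => a b /=; ring.
pose F n r := cos r - tpoly p n r; pose H n r := - sin r - tpoly q n r.
have e : (cos r -i* sin r) - \sum_(k < d) (- 'i%C) ^+ k * (r ^+ k / k`!%:R)%:C =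
    F d r +i* H d r.
  have h n : \sum_(k < n) (- 'i%C) ^+ k * (r ^+ k / k`!%:R)%:C =
      tpoly p n r +i* tpoly q n r.
    rewrite /tpoly; elim: n => [|n IH]; first by rewrite !big_ord0.
    rewrite !big_ord_recr /= IH /p /q; case: (_ ^+ n) => a b.
    by apply: complex_eq => /=; ring.
  by rewrite h; apply: complex_eq.
rewrite e /sqn /=; clear e.
pose Q (t : R * R) := t.1 ^+ 2 + t.2 ^+ 2 <= 1.
pose G n (t : R * R) r := t.1 * F n r + t.2 * H n r.
have Gb n t : Q t -> G n t r <= r ^+ n / n`!%:R.
  move=> Qt.
  apply: (@iterated_bound _ Q (fun t => (- t.2, t.1)) G _ _ _ _ n t r Qt r0).
  - by move=> t'; rewrite /Q /= sqrrN addrC.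
  - move=> [a b] s; rewrite /Q /G /F /H /tpoly !big_ord0 !subr0 /= => ab _.
    have := cos2Dsin2 s; move: (sqr_ge0 (a - cos s)) (sqr_ge0 (b + sin s)).
    by move=> *; nra.
  - move=> k [a b]; rewrite /G /F /H !tpoly_at0 cos0 sin0 /p /q expr0 /=.
    by ring.
  - move=> k [a b] s.
    have h1 := is_deriveZ a (is_deriveB (is_derive_cos s) (is_derive_tpoly p k s)).
    have h2 := is_deriveZ b (is_deriveB (is_deriveN (is_derive_sin s))
      (is_derive_tpoly q k s)).
    apply: is_derive_congr (is_deriveD h1 h2) _ _ => //.
    rewrite pS (_ : q \o S = fun k => - p k); last by apply/funext.
    rewrite (_ : tpoly (fun k => - p k) k s = - tpoly p k s); last first.
      by rewrite /tpoly -sumrN; apply: eq_bigr => i _; rewrite mulNr.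
    by rewrite /G /F /H /GRing.scale /=; ring.
set M := r ^+ d / d`!%:R.
have M0 : 0 <= M by rewrite divr_ge0 ?exprn_ge0.
have [z|z] := eqVneq (F d r ^+ 2 + H d r ^+ 2) 0; first by rewrite z sqr_ge0.
have zp : 0 < F d r ^+ 2 + H d r ^+ 2.
  by rewrite lt_neqAle eq_sym z addr_ge0// sqr_ge0.
pose w := Num.sqrt (F d r ^+ 2 + H d r ^+ 2).
have w2 : w ^+ 2 = F d r ^+ 2 + H d r ^+ 2 by rewrite sqr_sqrtr// ltW.
have w0 : 0 < w by rewrite sqrtr_gt0.
have wn0 : w != 0 by rewrite gt_eqF.
rewrite -w2 ler_sqr ?nnegrE ?(ltW w0)//.
have -> : w = G d (F d r / w, H d r / w) r.
  have -> : G d (F d r / w, H d r / w) r = (F d r ^+ 2 + H d r ^+ 2) / w.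
    by rewrite /G /=; ring.
  by rewrite -w2; field.
apply: Gb; rewrite /Q /=.
have -> : (F d r / w) ^+ 2 + (H d r / w) ^+ 2 = (F d r ^+ 2 + H d r ^+ 2) / w ^+ 2.
  by field.
by rewrite -w2 divff// expf_neq0.
Qed.

End Taylor.

(** * Paths, and entries of powers of a Laplacian *)

Section Paths.
Variables (X : countType) (E : rel X).

Lemma path_of_length0 x y : path_of_length E x y 0 <-> x = y.
Proof.
split=> [[s [_ <- /size0nil ->]]//|->]; by exists [::].
Qed.

Lemma path_of_lengthS x y n :
  path_of_length E x y n.+1 <-> exists2 z, E x z & path_of_length E z y n.
Proof.
split=> [[[|z s] [//=]]|[z xz [s [zs sy sn]]]].
  by move=> /andP[xz zs] sy [sn]; exists z => //; exists s.
by exists (z :: s); split => //=; [rewrite xz zs|rewrite sn].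
Qed.

Lemma gdistP x y : graph_connected E -> path_of_length E x y (gdist E x y) /\
  forall k, (k < gdist E x y)%N -> ~ path_of_length E x y k.
Proof.
move=> conn; rewrite /gdist; case: eqVneq => [->|xy].
  by split=> //; apply/path_of_length0.
pose Q := [set n | path_of_length E x y n /\
  forall k, path_of_length E x y k -> (n <= k)%N].
have : Q (xget 0%N Q).
  apply: xgetPex.
  have ex : exists n, `[< path_of_length E x y n >].
    by have [n xyn] := conn x y; exists n; exact/asboolP.
  exists (ex_minn ex); case: ex_minnP => n /asboolP xyn nmin; split=> // k xyk.
  by apply: nmin; exact/asboolP.
move=> [Q1 Q2]; split=> // k kd /Q2; by rewrite leqNgt kd.
Qed.

End Paths.

Section PowersOfLaplacian.
Variables (R : realType) (X : countType) (m : X -> R) (E : rel X).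
Hypothesis m_gt0 : forall x, 0 < m x.
Hypothesis graphE : combinatorial_graph E.
Variable a : nat -> X -> X -> R[i].
Hypothesis a0 : forall x y, a 0 x y = if x == y then (m x)%:C else 0.
Hypothesis a1 : forall x y, x != y -> a 1 x y <= 0 /\ (a 1 x y < 0 <-> E x y).
Hypothesis aS : forall n x y,
  let F z := (a 1 z x)^* * a n z y / (m z)%:C in
  csummable F /\ a n.+1 x y = csum F.

(** Induction on n along the recursion [aS].  If there is no path of length at
    most n from x to y, only the neighbours z of x contribute to the entry
    a (n+1) x y, since a n x y = 0.  There a 1 z x < 0, and a n z y has the sign
    (-1)^n or vanishes according to whether y is reached from z in n steps;
    so all terms have the sign (-1)^(n+1) and nothing cancels. *)
Lemma power_entries n x y :
  ((forall k, (k <= n)%N -> ~ path_of_length E x y k) -> a n x y = 0) /\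
  (path_of_length E x y n -> (forall k, (k < n)%N -> ~ path_of_length E x y k) ->
    0 < (-1) ^+ n * a n x y).
Proof.
have [symE irrE] := graphE.
elim: n x y => [|n IH] x y.
  rewrite a0 expr0 mul1r; split.
    by move=> /(_ 0%N isT); case: eqVneq => [->|//] []; exact/path_of_length0.
  by move=> /path_of_length0 -> _; rewrite eqxx ltr0c.
have [Fs ->] := aS n x y; set F := fun z => _ in Fs *.
have sgn (z : R[i]) : (-1) ^+ n.+1 * z = - ((-1) ^+ n * z).
  by rewrite exprS mulN1r mulNr.
have noadj z : z != x -> ~~ E x z -> F z = 0.
  move=> zx nE; have [le0 lt0] := a1 zx.
  suff e : a 1 z x = 0 by rewrite /F e conjC0 !mul0r.
  apply/eqP; apply: contraNT nE => az; rewrite symE; apply/lt0.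
  by rewrite lt_neqAle az.
have adj z : E x z -> exists2 c : R[i], 0 < c & F z = - c * a n z y.
  move=> xz; have zx : z != x.
    by apply: contraTneq xz => ->; rewrite irrE.
  have [_ [_ +]] := a1 zx; rewrite symE => /(_ xz).
  case e : (a 1 z x) => [p q]; rewrite ltcE /= => /andP[/eqP q0 p0].
  exists ((- p / m z)%:C); first by rewrite ltr0c divr_gt0// oppr_gt0.
  rewrite /F e -q0 conjE /= oppr0.
  rewrite rmorphM rmorphN fmorphV /=.
  rewrite -[p +i* 0]/(p%:C); ring.
have self : (forall k, (k <= n)%N -> ~ path_of_length E x y k) -> F x = 0.
  by move=> /(IH x y).1 h; rewrite /F h mulr0 mul0r.
have step z k : E x z -> path_of_length E z y k -> path_of_length E x y k.+1.
  by move=> xz zy; apply/path_of_lengthS; exists z.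
split.
  move=> nopath; rewrite (@csum1 _ _ _ x) => [|z zx].
    by apply: self => k kn; apply: nopath; exact: leqW.
  have [xz|nxz] := boolP (E x z); last exact: noadj.
  have [c _ ->] := adj z xz; rewrite (IH z y).1 ?mulr0// => k kn zy.
  exact: (nopath k.+1 _ (step _ _ xz zy)).
move=> /path_of_lengthS[z0 xz0 z0y] nopath.
have nz z : E x z -> forall k, (k < n)%N -> ~ path_of_length E z y k.
  by move=> xz k kn zy; exact: (nopath k.+1 _ (step _ _ xz zy)).
rewrite -csumZ//.
have pos z : E x z -> path_of_length E z y n -> 0 < (-1) ^+ n.+1 * F z.
  move=> xz zy; have [c c0 ->] := adj z xz.
  have := (IH z y).2 zy (nz z xz); rewrite sgn mulNr mulrN opprK mulrCA => h.
  exact: mulr_gt0.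
apply: (@csum_gt0 _ _ _ z0); last exact: pos.
  by have := csummableZ ((-1) ^+ n.+1) Fs.
move=> z; have [->|zx] := eqVneq z x.
  by rewrite self ?mulr0// => k kn; exact: nopath.
have [xz|nxz] := boolP (E x z); last by rewrite noadj// mulr0.
have [zy|nzy] := pselect (path_of_length E z y n).
  exact/ltW/pos.
have [c _ ->] := adj z xz; rewrite (IH z y).1 ?mulr0// => k.
by rewrite leq_eqVlt => /predU1P[->//|]; exact: nz.
Qed.

End PowersOfLaplacian.

(** * Matrix entries of functions of a Laplacian *)

Section SpectralLaplacian.
Variables (R : realType) (X : countType) (m : X -> R).
Hypothesis m_gt0 : forall x, 0 < m x.
Variables (E : rel X) (P : set R -> (X -> R[i]) -> (X -> R[i])).
Hypothesis graphE : combinatorial_graph E.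
Hypothesis pvmP : projection_valued_measure m P.
Local Notation one x := (indicator R x).
Local Notation S f := (spectral_integral m P f).
Local Notation B f u v := (spectral_sesquiform m P f u v).
Let root (s : R) : R[i] := (Num.sqrt s)%:C.
Hypothesis dom_pw : forall k x, spectral_dom m P (@pw R k) (one x).
Hypothesis dom_root : forall x, spectral_dom m P root (one x).
Hypothesis spectrum_ge0 :
  forall u, ell2 m u -> specmu m P u (@negative R) = 0%E.
Hypothesis laplace : forall x y, x != y ->
  let a := inner m (S root (one x)) (S root (one y)) in
  a <= 0 /\ (a < 0 <-> E x y).

Definition entry n x y := B (@pw R n) (one x) (one y).

Lemma inner_pw n x y : inner m (one x) (S (@pw R n) (one y)) = entry n x y.
Proof.
exact: (inner_spectral_integral m_gt0 pvmP (@cmeas_pw R n) (dom_pw n) (dom_pw n x)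
  (dom_pw n y)).
Qed.

Lemma entry0 x y : entry 0 x y = if x == y then (m x)%:C else 0.
Proof.
have xs := ell2_indicator m_gt0 x; have ys := ell2_indicator m_gt0 y.
rewrite /entry (_ : pw 0 = cind [set: R]); last first.
  by apply/funext => s; rewrite /pw /cind indicT expr0.
rewrite sesquiform_cind// (P_setT pvmP ys) inner_indicator /indicator.
by case: eqVneq => _; rewrite ?mul1r// mul0r.
Qed.

(** [laplace] is about the square root of the operator; by
    multiplicativity of the calculus its inner products are integrals of
    (sqrt s)^2, which is s on the spectrum. *)
Lemma entry1 x y : x != y -> entry 1 x y <= 0 /\ (entry 1 x y < 0 <-> E x y).
Proof.
move=> /laplace; have xs := ell2_indicator m_gt0 x.
have ys := ell2_indicator m_gt0 y.
have mroot : cmeas root.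
  by apply: cmeas_real; apply: continuous_measurable_fun; exact: sqrt_continuous.
rewrite (inner_spectral_integral2 m_gt0 pvmP mroot mroot dom_root dom_root
  (dom_root x) (dom_root y) (dom_root x) (dom_root y)).
rewrite (sesquiform_eq_nonneg m_gt0 pvmP spectrum_ge0 xs ys _ (@cmeas_pw R 1))//.
  by apply: cmeasM => //; exact: cmeas_conj.
move=> s s0; rewrite /root /pw conjE /= oppr0 expr1.
by apply: complex_eq => /=; rewrite ?mulr0 ?mul0r ?subr0 ?addr0// -expr2 sqr_sqrtr.
Qed.

Let conj_divr (z : R[i]) (r : R) : (z / r%:C)^* = z^* / r%:C.
Proof.
by rewrite -fmorphV /= !conjE; case: z => p q; apply: complex_eq => /=; ring.
Qed.

(** Expand <L 1_x, L^n 1_y> in coordinates: the value of L^n 1_y at z is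
    a_n(z, y) / m(z). *)
Lemma entryS n x y :
  let F z := (entry 1 z x)^* * entry n z y / (m z)%:C in
  csummable F /\ entry n.+1 x y = csum F.
Proof.
move=> F; have p1 : cmeas (@pw R 1) := @cmeas_pw R 1.
have pn : cmeas (@pw R n) := @cmeas_pw R n.
have e : entry n.+1 x y = inner m (S (@pw R 1) (one x)) (S (@pw R n) (one y)).
  rewrite (inner_spectral_integral2 m_gt0 pvmP p1 pn (dom_pw 1) (dom_pw n)
    (dom_pw 1 x) (dom_pw 1 y) (dom_pw n x) (dom_pw n y)).
  rewrite /entry; congr spectral_sesquiform; apply/funext => s.
  by rewrite /pw conjE /= oppr0 exprS -[_ +i* 0]/(_%:C) -rmorphM expr1.
have coord k z w : (S (@pw R k) (one w)) z = entry k z w / (m z)%:C.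
  rewrite -inner_pw inner_indicator mulfK// eq_complex /= negb_and.
  by rewrite gt_eqF.
have FE : F = fun z =>
    ((S (@pw R 1) (one x)) z)^* * (S (@pw R n) (one y)) z * (m z)%:C.
  apply/funext => z; have mz : (m z)%:C != 0 :> R[i].
    by rewrite eq_complex /= negb_and gt_eqF.
  transitivity ((entry 1 z x / (m z)%:C)^* * (entry n z y / (m z)%:C) * (m z)%:C).
    by rewrite conj_divr /F; field.
  by congr (_^* * _ * _); rewrite coord.
have ell2S k w : ell2 m (S (@pw R k) (one w)).
  exact: represents_ell2 (spectral_integral_represents m_gt0 pvmP (@cmeas_pw R k)
    (dom_pw k) (dom_pw k w)).
by split; [rewrite FE; exact: inner_summable|rewrite e FE].
Qed.

Let dom_sq f x : spectral_dom m P f (one x) -> cmeas f ->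
  sqintegrable (specmu m P (one x)) f.
Proof. by move=> h mf; have [] := (@spectral_domP _ _ m P _ (one x) mf).1 h. Qed.

(** In the Taylor expansion of f the entries of order less than the distance
    vanish, so only the term of order d is left. *)
Lemma entry_taylor (f : R -> R[i]) (c : nat -> R[i]) (K : R) x y (M : R) : cmeas f ->
  graph_connected E ->
  0 <= M -> (forall s, 0 <= s -> sqn (f s) <= M) -> 0 <= K ->
  let d := gdist E x y in
  (forall s, 0 <= s ->
    sqn (f s - \sum_(k < d.+1) c k * pw k s) <= (K * s ^+ d.+1) ^+ 2) ->
  `|inner m (one x) (S f (one y)) - c d * entry d x y| <=
    (K / 2)%:C * (entry d.+1 x x + entry d.+1 y y).
Proof.
move=> mf connE M0 fM K0 d rem.
have xs z := ell2_indicator m_gt0 z.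
have sqf z : sqintegrable (specmu m P (one z)) f.
  exact: (sqintegrable_nonneg m_gt0 pvmP spectrum_ge0 (xs z) mf M0 fM).
have domf z : spectral_dom m P f (one z).
  by apply/spectral_domP => //; split.
have sqp z k : sqintegrable (specmu m P (one z)) (@pw R k).
  exact: dom_sq (dom_pw k z) (@cmeas_pw R k).
rewrite (inner_spectral_integral m_gt0 pvmP mf domf (domf x) (domf y)).
have := sesquiform_taylor m_gt0 pvmP spectrum_ge0 (xs x) (xs y) mf (sqf x) (sqf y)
  (sqp x) (sqp y) K0 rem.
rewrite big_ord_recr /= big1 ?add0r// => k _.
have [_ short] := gdistP x y connE.
have [zero _] := power_entries m_gt0 graphE entry0 entry1 entryS k x y.
suff e : entry k x y = 0 by move: e; rewrite /entry => ->; rewrite mulr0.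
by apply: zero => j jk; apply: short; exact: leq_ltn_trans jk (ltn_ord k).
Qed.

Lemma entry_gdist x y : graph_connected E ->
  0 < (-1) ^+ gdist E x y * entry (gdist E x y) x y.
Proof.
move=> connE; have [xy short] := gdistP x y connE.
by have [_ ->] := power_entries m_gt0 graphE entry0 entry1 entryS (gdist E x y) x y.
Qed.

End SpectralLaplacian.

(** An operator without spectral resolution has powers with empty domain; so a
    single point in a domain provides the resolution, and the same one serves
    all functions. *)
Lemma spectral_calculusE (R : realType) (X : countType) (m : X -> R)
    (L : operator R X) (n : nat) u : dom (op_pow m L n) u ->
  exists2 P, spectral_resolution m L P &
    forall f, spectral_calculus m L f = spectral_integral m P f.
Proof.
rewrite /op_pow /spectral_calculus; case: pselect => // hP _.
by exists (projT1 (cid hP)) => //; exact: projT2 (cid hP).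
Qed.

(** * Short-time estimates *)

Theorem theorem2p2 (R : realType) (X : countType) (m : X -> R)
    (m_gt0 : forall x : X, 0 < m x)
    (E : rel X) (graphE : combinatorial_graph E) (connE : graph_connected E)
    (L : operator R X) (lapL : laplacian_based_on m E L)
    (Cc_dom : forall n : nat, @Cc R X `<=` dom (op_pow m L n))
    (x y : X) :
  let d := gdist E x y in
  let one z := @indicator R X z in
  let C := (inner m (one x) (op_pow m L d.+1 (one x)) +
            inner m (one y) (op_pow m L d.+1 (one y))) / (2 * (d.+1)`!%:R) in
  let a := `|inner m (one x) (op_pow m L d (one y))| in
  0 < a /\
  forall t : R, 0 <= t ->
    `|inner m (one x) (heat_operator m L t (one y)) -
      t%:C ^+ d * (a / d`!%:R)| <= t%:C ^+ d.+1 * C /\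
    `| `|inner m (one x) (unitary_operator m L t (one y))| -
      t%:C ^+ d * (a / d`!%:R)| <= t%:C ^+ d.+1 * C.
Proof.
have [saL posL Cc_root lapE] := lapL.
have [P [pvmP [domLP LP]] calc] :=
  spectral_calculusE (Cc_dom 0%N _ (@Cc_indicator R X x)).
have dom_pw k z : spectral_dom m P (@pw R k) (@indicator R X z).
  have := Cc_dom k _ (@Cc_indicator R X z); rewrite /op_pow calc.
  exact.
have dom_root z : spectral_dom m P (fun s => (Num.sqrt s)%:C) (@indicator R X z).
  have := Cc_root _ (@Cc_indicator R X z); rewrite /op_sqrt calc.
  exact.
(* The conditions on L are those on its first power. *)
have idE : (fun s : R => s%:C : R[i]) = @pw R 1.
  by apply/funext => s; rewrite /pw expr1.
have spectrum_ge0 u : ell2 m u -> specmu m P u (@negative R) = 0%E.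
  move=> us; apply: (specmu_negative m_gt0 pvmP us).
    by move=> z; rewrite idE.
  move=> w dw; have Lw : dom L w by rewrite domLP.
  by rewrite -LP//; exact: posL.
have laplace z w : z != w ->
    let a := inner m
      (spectral_integral m P (fun s => (Num.sqrt s)%:C) (@indicator R X z))
      (spectral_integral m P (fun s => (Num.sqrt s)%:C) (@indicator R X w)) in
    a <= 0 /\ (a < 0 <-> E z w).
  by move=> zw; have := lapE z w zw; rewrite /op_sqrt calc.
have powE k z w : inner m (@indicator R X z) (op_pow m L k (@indicator R X w)) =
    entry m P k z w.
  rewrite /op_pow calc; exact: (inner_pw m_gt0 pvmP dom_pw).
move=> d one C a.
have a_sign : 0 < (-1) ^+ d * entry m P d x y.
  exact: (entry_gdist m_gt0 graphE pvmP dom_pw dom_root spectrum_ge0 laplace).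
have aE : a = (-1) ^+ d * entry m P d x y.
  by rewrite /a powE -[RHS](gtr0_norm a_sign) normrMsign.
split; first by rewrite aE.
move=> t t0.
pose K := t ^+ d.+1 / d.+1`!%:R.
have K0 : 0 <= K by rewrite divr_ge0 ?exprn_ge0.
have CE : t%:C ^+ d.+1 * C =
    (K / 2)%:C * (entry m P d.+1 x x + entry m P d.+1 y y).
  rewrite /C !powE /K !rmorphM /= !fmorphV rmorphXn /= !rmorph_nat.
  rewrite invfM; move: (t%:C ^+ d.+1) (entry _ _ _ _ _ + _) => T A.
  by rewrite mulrCA mulrC [2^-1 * _]mulrC mulrA.
rewrite CE.
have KsE s : K * s ^+ d.+1 = (t * s) ^+ d.+1 / d.+1`!%:R.
  by rewrite /K exprMn; ring.
have mts : measurable_fun [set: R] (fun s : R => t * s).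
  by apply: measurable_funM; [exact: measurable_cst|exact: measurable_id].
split.
- rewrite /heat_operator calc.
  pose c k := ((-1) ^+ k * (t ^+ k / k`!%:R))%:C : R[i].
  have -> : t%:C ^+ d * (a / d`!%:R) = c d * entry m P d x y.
    rewrite aE /c !rmorphM /= fmorphV rmorphXn rmorphXn rmorphN1 rmorph_nat /=.
    by ring.
  apply: (entry_taylor (c := c) m_gt0 graphE pvmP dom_pw dom_root spectrum_ge0
    laplace _ connE ler01 _ K0).
  + apply: cmeas_real; apply: (measurableT_comp (@measurable_expR R)).
    by apply: measurable_funM; [exact: measurable_cst|exact: measurable_id].
  + move=> s s0; rewrite sqn_real expr_le1 ?expR_ge0// -expR0 ler_expR mulNr.
    by rewrite oppr_le0 mulr_ge0.
  + move=> s s0; rewrite -/d KsE.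
    have := expR_remainder d.+1 (mulr_ge0 t0 s0); rewrite -sqn_real.
    congr (sqn _ <= _); rewrite rmorphB rmorph_sum mulNr; congr (_ - _).
    apply: eq_bigr => k _; rewrite /c /pw -rmorphM; congr (_%:C).
    by rewrite exprMn; ring.
- rewrite /unitary_operator calc.
  pose c k := (- 'i%C) ^+ k * (t ^+ k / k`!%:R)%:C : R[i].
  have normc : `|c d * entry m P d x y| = t%:C ^+ d * (a / d`!%:R).
    rewrite /a powE /c !normrM normrX normrN.
    have -> : `|'i%C : R[i]| = 1.
      by rewrite normc_def /= expr0n expr1n add0r sqrtr1.
    rewrite expr1n mul1r rmorphM fmorphV rmorphXn rmorph_nat /=.
    rewrite normrM normfV normr_nat normrX (ger0_norm (_ : 0 <= t%:C)) ?ler0c//.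
    by ring.
  rewrite -normc; apply: le_trans (ler_dist_dist _ _) _.
  apply: (entry_taylor (c := c) m_gt0 graphE pvmP dom_pw dom_root spectrum_ge0
    laplace _ connE ler01 _ K0).
  + split => /=.
      apply: (measurableT_comp _ mts).
      by apply: continuous_measurable_fun; exact: continuous_cos.
    apply: measurable_funN; apply: (measurableT_comp _ mts).
    by apply: continuous_measurable_fun; exact: continuous_sin.
  + by move=> s s0; rewrite /sqn /= sqrrN cos2Dsin2.
  + move=> s s0; rewrite -/d KsE.
    have := cis_remainder d.+1 (mulr_ge0 t0 s0).
    congr (sqn _ <= _); congr (_ - _).
    apply: eq_bigr => k _; rewrite /c /pw -mulrA -rmorphM; congr (_ * _%:C).
    by rewrite exprMn; ring.
Qed.
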